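(* Let $d\ge 1$, let $\delta=(1\ 2\ \cdots\ d)\in\mathrm{Sym}_d$, and let $\psi\colon\mathrm{Sym}_d\to\Pi(d)$ send a permutation to the partition of $\{1,\dots,d\}$ into its orbits. Define $\Psi\colon\mathrm{Mult}(\mathrm{Sym}_d,\mathbf S)\to\Pi_d(\mathbf S)$ by sending the $\mathrm{Sym}_d$-multiset $0^{x_L}s_1^{x_1}\cdots s_k^{x_k}1^{1}$ to the partition $0^{\psi(x_L)}s_1^{\psi(x_1)}\cdots s_k^{\psi(x_k)}$. Then $\Psi$ restricts to a poset isomorphism from $\mathcal F(\mathrm{Sym}_d,\delta,\mathbf S)$ onto the poset $\mathrm{NC}_d(\mathbf S)$ of degree-$d$ noncrossing partitions of the unit circle.
   Context: Group-theoretic setup: $G=\mathrm{Sym}_d$ with generating set $X=T$, the set of all transpositions (closed under conjugation). For $h\in G$, $\ell(h)$ is the minimal number of transpositions whose product is $h$. For $h,g\in G$ write $h\le g$ if $\ell(h)+\ell(h^{-1}g)=\ell(g)$; $[1,g]=\{h:h\le g\}$. A linear factorization of $h\in G$ is a row vector $[x_L\ x_1\ \cdots\ x_k\ x_R]$ ($k\ge0$) of elements of $G$ with $x_1,\dots,x_k\ne 1$ ($x_L,x_R$ may be trivial), $\ell(x_L)+\ell(x_1)+\cdots+\ell(x_k)+\ell(x_R)=\ell(h)$, and $x_Lx_1\cdots x_kx_R=h$. A $G$-multiset on a set $S$ is a function $S\to G$ that is the identity at all but finitely many points; $\mathrm{Mult}(G,S)$ denotes the set of these. A weighted linear factorization of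 $h$ is a $G$-multiset $\mathbf u$ on $\mathbf I=[0,1]$ such that, if $0<s_1<\cdots<s_k<1$ are the points of $(0,1)$ where $\mathbf u$ is nontrivial, then $[\mathbf u(0)\ \mathbf u(s_1)\cdots\mathbf u(s_k)\ \mathbf u(1)]$ is a linear factorization of $h$; it is written $0^{x_L}s_1^{x_1}\cdots s_k^{x_k}1^{x_R}$ with $x_L=\mathbf u(0)$, $x_i=\mathbf u(s_i)$, $x_R=\mathbf u(1)$. Let $\mathcal F(G,g,\mathbf I)$ be the set of all weighted linear factorizations of all $h\in[1,g]$, ordered by $\mathbf v\subseteq\mathbf u$ iff $\mathbf v(r)\le\mathbf u(r)$ for all $r\in\mathbf I$. Two elements $0^{x_L}s_1^{x_1}\cdots s_k^{x_k}1^{x_R}$ and $0^{y_L}s_1^{y_1}\cdots s_k^{y_k}1^{y_R}$ of $\mathcal F(G,g,\mathbf I)$ (same points $s_i$) are equivalent if $x_i=y_i$ for all $1\le i\le k$ and $gx_Rg^{-1}x_L=gy_Rg^{-1}y_L$. The set of equivalence classes is $\mathcal F(G,g,\mathbf S)$, with the order $[\mathbf v]\le[\mathbf u]$ iff $\mathbf v'\subseteq\mathbf u'$ for some representatives. Each class has a unique representative of the form $0^{z_L}s_1^{z_1}\cdots s_k^{z_k}1^1$, which is regarded as a $G$-multiset on the unit circle $\mathbf S\subset\mathbb C$ via $s\mapsto e^{2\pi i s}$ (so $0$ and $1$ are identified); this is how $\mathcal F(\mathrm{Sym}_d,\delta,\mathbf S)\subseteq\mathrm{Mult}(\mathrm{Sym}_d,\mathbf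 S)$. Partitions: $\Pi(P)$ is the set of partitions of a set $P$ ordered by refinement. A partition of a subset of $\mathbb C$ is noncrossing if the convex hulls of its blocks are pairwise disjoint. A partition $\pi$ of $\mathbf S$ is a degree-$d$ partition if $z^d=w^d$ whenever $z,w$ lie in the same block; $\Pi_d(\mathbf S)$ is the set of these and $\mathrm{NC}_d(\mathbf S)$ the subposet of noncrossing ones. Notation: given $0\le s_1<\dots<s_k<1$ (with $s_L=0$) and partitions $\pi_L,\pi_1,\dots,\pi_k$ of $\{1,\dots,d\}$, the partition $0^{\pi_L}s_1^{\pi_1}\cdots s_k^{\pi_k}$ of $\mathbf S$ is obtained by identifying, for each $j$, the $d$ preimages of $e^{2\pi i s_j}$ under $z\mapsto z^d$ with $\{1,\dots,d\}$ in increasing order of argument in $[0,2\pi)$, taking the blocks of $\pi_j$ on these preimages, and letting all other points of $\mathbf S$ be singletons. *)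

(* Defs.v *)
From HB Require Import structures.
From mathcomp Require Import all_boot all_order all_algebra all_fingroup.
From mathcomp Require Import all_classical all_reals trigo.
Set Implicit Arguments. Unset Strict Implicit. Unset Printing Implicit Defensive.
Import Order.TTheory GRing.Theory Num.Theory.

(* The symmetric group Sym_d acts on 'I_d = {0,...,d-1}; the point i : 'I_d  *)
(* stands for the label i+1 of {1,...,d}.                                   *)
(* Products are FUNCTION COMPOSITION (right-to-left), as in the paper:      *)
(*   comp x y = x o y, i.e. (comp x y) i = x (y i).                          *)
(* (mathcomp's own product (x * y)%g is left-to-right: (x*y) i = y (x i).)  *)
Section SymGroup.
Variable d : nat.
Local Notation Sd := {perm 'I_d}.

Definition comp (x y : Sd) : Sd := (y * x)%g.

(* x_1 x_2 ... x_n  (composition of the list, rightmost factor acts first) *)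
Definition cprod (xs : seq Sd) : Sd := (\prod_(x <- rev xs) x)%g.

Definition tfactorable (h : Sd) (n : nat) : bool :=
  [exists ts : n.-tuple ('I_d * 'I_d),
     all (fun p => p.1 != p.2) ts && (h == cprod [seq tperm p.1 p.2 | p <- ts])].

Lemma tfactorable_ex (h : Sd) : exists n, tfactorable h n.
Proof.
case: (prod_tpermP h) => ts Eh dts.
exists (size (rev ts)); apply/existsP; exists (in_tuple (rev ts)) => /=.
rewrite all_rev dts /= /cprod map_rev revK big_map -Eh.
exact: eqxx.
Qed.

Definition ell (h : Sd) : nat := ex_minn (tfactorable_ex h).

Definition absle (h g : Sd) : bool :=
  ell h + ell (comp h^-1 g) == ell g.

Definition psi (x : Sd) (i j : 'I_d) : Prop := j \in porbit x i.

Definition delta : Sd := perm (@ordS_inj d).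

End SymGroup.

Section Factorizations.
Variable R : realType.
Variable d : nat.
Local Notation Sd := {perm 'I_d}.
Local Open Scope ring_scope.

Definition multI (u : R -> Sd) : Prop :=
  (forall r, u r != 1%g -> 0 <= r <= 1) /\
  (exists l : seq R, forall r, u r != 1%g -> r \in l).

Definition interior_support (u : R -> Sd) (s : seq R) : Prop :=
  sorted <%R s /\ (forall r, r \in s -> 0 < r < 1) /\
  (forall r, 0 < r < 1 -> (u r != 1%g) = (r \in s)).

Definition linfact (h : Sd) (xs : seq Sd) : Prop :=
  sumn (map (@ell d) xs) = ell h /\ cprod xs = h.

Definition wlf (h : Sd) (u : R -> Sd) : Prop :=
  multI u /\ exists s : seq R, interior_support u s /\
    linfact h (u 0 :: map u s ++ [:: u 1]).

Definition FI (g : Sd) (u : R -> Sd) : Prop :=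
  exists h : Sd, absle h g /\ wlf h u.

Definition msub (v u : R -> Sd) : Prop :=
  forall r, absle (v r) (u r).

Definition FIequiv (g : Sd) (u v : R -> Sd) : Prop :=
  (forall r, 0 < r < 1 -> u r = v r) /\
  comp (comp (comp g (u 1)) g^-1) (u 0) = comp (comp (comp g (v 1)) g^-1) (v 0).

(* Elements of F(G,g,S), viewed inside Mult(G,S): a G-multiset on S is      *)
(* represented by w : R -> Sd, where w s (0 <= s < 1) is the value at the   *)
(* point exp(2 pi i s); w is the identity outside [0,1).                    *)
(* Its I-representative is 0^{w 0} s_1^{w s_1} ... 1^1.                     *)
Definition toI (w : R -> Sd) : R -> Sd :=
  fun r => if (0 <= r) && (r < 1) then w r else 1%g.

Definition multS (w : R -> Sd) : Prop :=
  (forall s, w s != 1%g -> 0 <= s < 1) /\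
  (exists l : seq R, forall s, w s != 1%g -> s \in l).

Definition FS (g : Sd) (w : R -> Sd) : Prop := multS w /\ FI g (toI w).

Definition FSle (g : Sd) (v u : R -> Sd) : Prop :=
  exists v' u', FI g v' /\ FI g u' /\ FIequiv g v' (toI v) /\
                FIequiv g u' (toI u) /\ msub v' u'.

End Factorizations.

Section Circle.
Variable R : realType.
Local Open Scope ring_scope.
Local Notation C := (R * R)%type.

Definition cmul (z w : C) : C := (z.1 * w.1 - z.2 * w.2, z.1 * w.2 + z.2 * w.1).
Fixpoint cpow (z : C) (n : nat) : C :=
  if n is n'.+1 then cmul z (cpow z n') else (1, 0).

Definition onS (z : C) : Prop := z.1 ^+ 2 + z.2 ^+ 2 = 1.

Definition expi (t : R) : C := (cos (2 * pi * t), sin (2 * pi * t)).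

Definition partS (E : C -> C -> Prop) : Prop :=
  (forall z w, E z w -> onS z /\ onS w) /\
  (forall z, onS z -> E z z) /\
  (forall z w, E z w -> E w z) /\
  (forall z w y, E z w -> E w y -> E z y).

Definition block (E : C -> C -> Prop) (z : C) : C -> Prop := fun w => E z w.

Definition conv (A : C -> Prop) (p : C) : Prop :=
  exists (n : nat) (c : 'I_n -> R) (q : 'I_n -> C),
    (forall i, 0 <= c i) /\ \sum_i c i = 1 /\ (forall i, A (q i)) /\
    p = (\sum_i c i * (q i).1, \sum_i c i * (q i).2).

Definition degd (d : nat) (E : C -> C -> Prop) : Prop :=
  partS E /\ forall z w, E z w -> cpow z d = cpow w d.

Definition noncrossing (E : C -> C -> Prop) : Prop :=
  forall z w, onS z -> onS w -> ~ E z w ->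
    forall p, conv (block E z) p -> conv (block E w) p -> False.

Definition NCd (d : nat) (E : C -> C -> Prop) : Prop := degd d E /\ noncrossing E.

Definition refines (E F : C -> C -> Prop) : Prop := forall z w, E z w -> F z w.
Definition same_part (E F : C -> C -> Prop) : Prop := forall z w, E z w <-> F z w.

(* the partition 0^{pi_L} s_1^{pi_1} ... s_k^{pi_k} of S, given the family   *)
(* pis s (0 <= s < 1) of partitions of {1..d} (discrete at all other s): the *)
(* d preimages of exp(2 pi i s) under z |-> z^d, in increasing order of     *)
(* argument in [0,2pi), are exp(2 pi i (s+m)/d), m = 0..d-1 (labels m+1).  *)
Definition preim (d : nat) (s : R) (m : 'I_d) : C := expi ((s + m%:R) / d%:R).

Definition part_notation (d : nat) (pis : R -> 'I_d -> 'I_d -> Prop) : C -> C -> Prop :=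
  fun z w => (onS z /\ z = w) \/
    exists s, 0 <= s < 1 /\ exists i j : 'I_d,
      z = preim s i /\ w = preim s j /\ pis s i j.

Definition Psi (d : nat) (w : R -> {perm 'I_d}) : C -> C -> Prop :=
  part_notation (fun s => psi (w s)).

End Circle.

(* Main.v *)
(* Place the sheets (m, j), m < d, j < K, of a factorization x_0 ... x_(K-1) in
   lexicographic order around the circle; let X be the direct sum of the x_j and
   c the cycle to the next point.  The orbits of c X^-1 correspond to those of
   delta h^-1, h = x_0 ... x_(K-1), so "minimal factorization of an element
   below delta" says exactly that X and c X^-1 together have dK + 1 cycles.
   A cycle of a permutation s of a finite chain contains at least one weak
   descent (s t <= t), the weak descents of X and c X^-1 always number dK + 1 in
   total, and so minimality means that both permutations have exactly one weak
   descent per cycle.  This is in turn equivalent to: the x_j rotate each of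
   their orbits increasingly, and X has no crossing a < b < X a < X b.
   Geometrically, crossing chords meet, while two non-crossing orbits are
   separated by the line through some t and X t. *)
Require Import Defs.
From HB Require Import structures.
From mathcomp Require Import all_boot all_order all_algebra all_fingroup.
From mathcomp Require Import all_classical all_reals trigo.
From mathcomp Require Import zify ring lra.
(* Defs again, so that its cprod is not the central product of fingroup. *)
Require Import Defs.
Set Implicit Arguments. Unset Strict Implicit. Unset Printing Implicit Defensive.
Import Order.TTheory GRing.Theory Num.Theory.

(** * Cycles and transpositions *)

Definition ncyc (T : finType) (s : {perm T}) := #|porbits s|.

Section Orbits.
Variable T : finType.
Implicit Types (s x y : {perm T}) (t u a b : T).

Lemma porbit_trans s a b c :
  b \in porbit s a -> c \in porbit s b -> c \in porbit s a.
Proof. by rewrite -eq_porbit_mem => /eqP->. Qed.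

Lemma mem_porbit1 s t : s t \in porbit s t.
Proof. by have := mem_porbit s 1 t; rewrite expg1. Qed.

Lemma porbit_closed s (A : pred T) t u :
  (forall v, A v -> A (s v)) -> A t -> u \in porbit s t -> A u.
Proof.
move=> cl At /porbitP[i ->]; elim: i => [|i IH]; first by rewrite expg0 perm1.
by rewrite expgSr permM cl.
Qed.

Lemma porbit_sub s x t u :
  (forall v, s v \in porbit x v) -> u \in porbit s t -> u \in porbit x t.
Proof.
move=> h; apply: (@porbit_closed s (mem (porbit x t))); last exact: porbit_id.
by move=> v /= /porbit_trans -> //.
Qed.

Lemma perm_in_porbit s a b : (s a \in porbit s b) = (a \in porbit s b).
Proof.
apply/idP/idP => h; last by apply: porbit_trans h _; exact: mem_porbit1.
by apply: porbit_trans h _; rewrite porbit_sym mem_porbit1.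
Qed.

Lemma ncyc_tperm s a b :
  ncyc (tperm a b * s)%g + (a \notin porbit s b).*2 = ncyc s + (a != b).
Proof. exact: porbits_mul_tperm. Qed.

(** The map [f] need not commute with the permutations: being onto and matching orbits makes
    preimage a bijection between orbits. This freedom allows the levels to be collapsed in
    [ncyc_lquot]. *)
Lemma ncyc_semiconj (U : finType) (f : T -> U) s (r : {perm U}) :
  (forall z, exists t, f t = z) ->
  (forall t u, (u \in porbit s t) = (f u \in porbit r (f t))) ->
  ncyc s = ncyc r.
Proof.
move=> surj comp; rewrite /ncyc.
have E t : f @^-1: porbit r (f t) = porbit s t by apply/setP => u; rewrite inE comp.
have -> : porbits s = (fun O : {set U} => f @^-1: O) @: porbits r.
  apply/setP => O; apply/imsetP/imsetP => [[t _ ->]|[_ /imsetP[z _ ->] ->]].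
    by exists (porbit r (f t)); rewrite ?E //; apply: imset_f.
  by have [t <-] := surj z; exists t; rewrite ?E.
rewrite card_in_imset // => O1 O2 _ _ /setP eqO; apply/setP => z.
by have [t <-] := surj z; have := eqO t; rewrite !inE.
Qed.

Lemma ncycJ s x : ncyc (s ^ x)%g = ncyc s.
Proof.
rewrite -(@ncyc_semiconj T x s) // => [z|t u].
  by exists (x^-1 z)%g; rewrite permKV.
have H w : (s ^ x)%g (x w) = x (s w) by rewrite conjgE !permM permK.
have Hn n w : ((s ^ x) ^+ n)%g (x w) = x ((s ^+ n)%g w).
  by elim: n w => [|n IH] w; rewrite ?expg0 ?perm1 // expgS permM H IH expgS permM.
apply/porbitP/porbitP => -[i e]; exists i; rewrite ?e ?Hn //.
by apply: (@perm_inj _ x); rewrite -Hn.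
Qed.

Lemma ncyc1 : ncyc (1 : {perm T})%g = #|T|.
Proof.
rewrite /ncyc card_imset // => a b /eqP; rewrite eq_porbit_mem => /porbitP[i ->].
by rewrite expg1n perm1.
Qed.

(** Multiplying twice by the same transposition returns to [s]. The first multiplication loses a
    cycle, so the second must gain one, which needs [a] and [b] in one orbit of the product. *)
Lemma tperm_splice s a b : a \notin porbit s b ->
  a \in porbit (tperm a b * s)%g b /\
  forall t, s t \in porbit (tperm a b * s)%g t.
Proof.
move=> nab; set r := (_ * s)%g.
have ab : a != b by apply: contraNneq nab => ->; exact: porbit_id.
have abr : a \in porbit r b.
  have e1 := ncyc_tperm s a b; have e2 := ncyc_tperm r a b.
  rewrite /r mulgA tperm2 mul1g -/r in e2; rewrite nab ab -/r in e1 e2.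
  by case: (a \in porbit r b) e2 => // e2; lia.
split=> // t.
have -> : s t = r (tperm a b t) by rewrite /r permM tpermK.
case: tpermP => [->|->|_ _]; rewrite ?perm_in_porbit ?porbit_id //.
by rewrite porbit_sym.
Qed.

Definition tprod (ts : seq (T * T)) : {perm T} := (\prod_(p <- ts) tperm p.1 p.2)%g.

Lemma tprod_cons p ts : tprod (p :: ts) = (tperm p.1 p.2 * tprod ts)%g.
Proof. by rewrite /tprod big_cons. Qed.

Lemma tprod_cat ts ts' : tprod (ts ++ ts') = (tprod ts * tprod ts')%g.
Proof. by rewrite /tprod big_cat. Qed.

Lemma tprod_porbits ts : #|T| <= size ts + ncyc (tprod ts).
Proof.
elim: ts => [|[a b] ts IH]; first by rewrite /tprod big_nil ncyc1.
have := ncyc_tperm (tprod ts) a b; rewrite tprod_cons [size _]/= [(a, b).1]/= [(a, b).2]/=.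
have [->|_] := eqVneq a b; first by rewrite porbit_id; lia.
by case: (a \in _); lia.
Qed.

(** In a word of minimal size every transposition has to merge two orbits, and later merges only
    enlarge them. Both ends of each letter thus stay in one orbit of the product. *)
Lemma tprod_minimal ts : size ts + ncyc (tprod ts) = #|T| ->
  forall p, p \in ts -> p.1 \in porbit (tprod ts) p.2.
Proof.
elim: ts => [//|[a b] ts IH]; rewrite tprod_cons [size _]/= [(a, b).1]/= [(a, b).2]/= => mn.
have := ncyc_tperm (tprod ts) a b; have := tprod_porbits ts.
case: (boolP (a \in _)) => [_|nab] h1 h2; first by case: (a != b) h2 => h2; lia.
have [abr cl] := tperm_splice nab.
have ab : a != b by apply: contraNneq nab => ->; exact: porbit_id.
rewrite ab in h2; have {}IH := IH ltac:(lia).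
move=> p; rewrite inE => /orP[/eqP-> //|/IH].
exact: porbit_sub.
Qed.

Lemma tprod_sub s ts t : (forall p, p \in ts -> p.1 \in porbit s p.2) ->
  tprod ts t \in porbit s t.
Proof.
elim: ts t => [|[a b] ts IH] t h; first by rewrite /tprod big_nil perm1 porbit_id.
rewrite tprod_cons permM /=; apply: (@porbit_trans _ _ (tperm a b t)).
  have ab := h (a, b) (mem_head _ _); rewrite /= in ab.
  by case: tpermP => [->|->|_ _]; rewrite ?porbit_id // porbit_sym.
by apply: IH => p pts; apply: h; rewrite inE pts orbT.
Qed.

Lemma tprod_exists s : exists2 ts : seq (T * T),
  tprod ts = s /\ all (fun p => p.1 != p.2) ts & size ts + ncyc s = #|T|.
Proof.
have [n le] := ubnP (#|T| - ncyc s); elim: n s le => // n IH s le.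
have [/eqP ->|s1] := boolP (s == 1%g).
  by exists [::]; rewrite ?ncyc1 // /tprod big_nil.
have /existsP[a sa] : [exists a, s a != a].
  apply: contraR s1; rewrite negb_exists => /forallP h; apply/eqP/permP => a.
  by rewrite perm1; have := h a; rewrite negbK => /eqP.
have asa : s a \in porbit s a := mem_porbit1 s a.
have := ncyc_tperm s a (s a); rewrite eq_sym sa porbit_sym asa => e.
have cT : ncyc (tperm a (s a) * s)%g <= #|T|.
  exact: leq_trans (leq_imset_card _ _) _.
have [|ts [ts1 ts2] ts3] := IH (tperm a (s a) * s)%g; first by lia.
exists ((a, s a) :: ts); last by rewrite [size _]/=; lia.
by rewrite tprod_cons ts1 mulgA tperm2 mul1g /= ts2 eq_sym sa.
Qed.

End Orbits.

(** * Permutations with increasing cycles *)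

Section Increasing.
Variables (T : finType) (pos : T -> nat).
Hypothesis pos_inj : injective pos.
Implicit Types (s x y : {perm T}) (t u v a b : T).

Definition wdes s := [set t | pos (s t) <= pos t].

(* Every cycle, read from its least element, is increasing. *)
Definition incr s := forall t u,
  pos (s t) <= pos t -> u \in porbit s t -> pos (s t) <= pos u <= pos t.

(** Only an escape of [s b] above [s a] is forbidden. With [incr], an escape to [a] or below is
    excluded as well, as [nocross_up] shows. *)
Definition nocross s := forall a b,
  pos a < pos b -> pos b < pos (s a) -> pos (s b) <= pos (s a).

Lemma porbit_max s t :
  exists2 u, u \in porbit s t & forall v, v \in porbit s t -> pos v <= pos u.
Proof. by case: (@arg_maxnP _ t (mem (porbit s t)) pos (porbit_id s t)) => u; exists u. Qed.

Lemma porbit_min s t :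
  exists2 u, u \in porbit s t & forall v, v \in porbit s t -> pos u <= pos v.
Proof. by case: (@arg_minnP _ t (mem (porbit s t)) pos (porbit_id s t)) => u; exists u. Qed.

(** The largest element of an orbit is a weak descent. *)
Lemma porbits_wdes s : porbits s = porbit s @: wdes s.
Proof.
apply/setP => O; apply/imsetP/imsetP => [[t _ ->]|[t _ ->]]; last by exists t.
have [u ut umax] := porbit_max s t; exists u.
  by rewrite inE umax // perm_in_porbit.
by apply/esym/eqP; rewrite eq_porbit_mem.
Qed.

Lemma ncyc_wdes s : ncyc s <= #|wdes s|.
Proof. by rewrite /ncyc porbits_wdes leq_imset_card. Qed.

(** Equality means one weak descent per cycle. The maximum of a cycle and the predecessor of its
    minimum are both weak descents, so they coincide. *)
Lemma incrP s : incr s <-> ncyc s = #|wdes s|.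
Proof.
split=> [inc|].
  rewrite /ncyc porbits_wdes card_in_imset // => t u; rewrite !inE => td ud /eqP.
  rewrite eq_porbit_mem => tu; apply: pos_inj; apply/eqP; rewrite eqn_leq.
  have /andP[_ ->] := inc _ _ ud tu.
  by rewrite porbit_sym in tu; have /andP[_ ->] := inc _ _ td tu.
rewrite /ncyc porbits_wdes => /eqP/imset_injP inj t u td ut.
have uniq v : pos (s v) <= pos v -> v \in porbit s t -> v = t.
  by move=> vd vt; apply: inj; rewrite ?inE //; apply/eqP; rewrite eq_porbit_mem.
have [M Mt Mmax] := porbit_max s t; have [m mt mmin] := porbit_min s t.
have EM : M = t by apply: uniq => //; rewrite Mmax // perm_in_porbit.
have Em : (s^-1 m)%g = t.
  have h : (s^-1 m)%g \in porbit s t by rewrite -perm_in_porbit permKV.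
  by apply: uniq => //; rewrite permKV mmin.
by rewrite -{1}Em permKV mmin // -EM Mmax.
Qed.

(** A discrete intermediate value argument. *)
Lemma porbit_step s c t u : u \in porbit s t -> pos t <= c < pos u ->
  exists2 v, v \in porbit s t & pos v <= c < pos (s v).
Proof.
move=> /porbitP[n ->]; elim: n => [|n IH]; first by rewrite expg0 perm1; lia.
rewrite expgSr permM => /andP[tc cu].
have [c1|c1] := ltnP c (pos ((s ^+ n)%g t)); first by apply: IH; lia.
by exists ((s ^+ n)%g t); rewrite ?mem_porbit // c1 cu.
Qed.

(** Infinite descent: were [b] strictly between [a] and [s a], its predecessor would lie below [b]
    and form with [a], in one order or the other, a smaller counterexample. *)
Lemma incr_gap s a b : incr s -> b \in porbit s a -> pos a < pos b -> pos (s a) <= pos b.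
Proof.
move=> inc; have [n le] := ubnP (pos a + pos b); elim: n a b le => // n IH a b le ba ab.
rewrite leqNgt; apply/negP => bsa.
have b1s : s (s^-1 b)%g = b by rewrite permKV.
set b1 := (s^-1 b)%g in b1s.
have b1a : b1 \in porbit s a by rewrite -perm_in_porbit b1s.
have b1b : pos b1 < pos b.
  rewrite ltnNge; apply/negP => h; rewrite porbit_sym in b1a.
  by have := inc b1 a; rewrite b1s => /(_ h b1a); lia.
have [h|h|h] := ltngtP (pos a) (pos b1).
- by have := IH a b1 ltac:(lia) b1a h; lia.
- by rewrite porbit_sym in b1a; have := IH b1 a ltac:(lia) b1a h; rewrite b1s; lia.
- by move: bsa; rewrite (pos_inj h) b1s; lia.
Qed.

(** If [s b] fell to [a] or below, the cycle of [b] would climb back over [a] by a step from some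
    [j], landing no higher than [b]. Then [s a] escapes above [s j]. *)
Lemma nocross_up s a b : incr s -> nocross s ->
  pos a < pos b < pos (s a) -> pos a < pos (s b) < pos (s a).
Proof.
move=> inc nc /andP[ab ba].
have le := nc _ _ ab ba.
have -> : pos (s b) < pos (s a).
  by rewrite ltn_neqAle le andbT; apply: contraTneq ab => /pos_inj/perm_inj->; lia.
rewrite andbT ltnNge; apply/negP => sba.
have bd : pos (s b) <= pos b by lia.
have bo : b \in porbit s (s b) by rewrite porbit_sym mem_porbit1.
have [j jo /andP[ja aj]] := porbit_step bo (c := pos a) ltac:(lia).
have {}jo : j \in porbit s b by apply: porbit_trans jo; exact: mem_porbit1.
have sjo : s j \in porbit s b by rewrite perm_in_porbit.
have /andP[_ h] := inc _ _ bd sjo.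
have ne : pos j != pos a by apply: contraTneq ba => /pos_inj <-; lia.
have := nc j a ltac:(lia) aj; lia.
Qed.

(** Leaving the span of the cycle of [a] upwards crosses the step of that cycle which jumps over
    [b]. After leaving downwards, the cycle of [b] must climb back by a step from some [j], and the
    step of the cycle of [a] over [s j] crosses it. *)
Lemma nocross_down s a b : incr s -> nocross s -> pos (s a) <= pos a ->
  pos (s a) <= pos b <= pos a -> pos (s a) <= pos (s b) <= pos a.
Proof.
move=> inc nc ad /andP[ab ba].
have [bo|bo] := boolP (b \in porbit s a).
  by apply: inc => //; rewrite perm_in_porbit.
have ao : a \in porbit s (s a) by rewrite porbit_sym mem_porbit1.
have nb t : t \in porbit s (s a) -> pos t != pos b.
  move=> h; apply: contraNneq bo => /pos_inj <-.
  exact: porbit_trans (mem_porbit1 _ _) h.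
have nb1 := nb _ ao; have nb2 := nb _ (porbit_id _ _).
have so t : t \in porbit s (s a) -> pos (s a) <= pos t <= pos a.
  by move=> h; apply: inc => //; apply: porbit_trans h; exact: mem_porbit1.
apply/andP; split; rewrite leqNgt; apply/negP => h; last first.
  have [j jo /andP[jb bj]] := porbit_step ao (c := pos b) ltac:(lia).
  have := nb _ jo; have := so (s j); rewrite perm_in_porbit => /(_ jo) h1 h2.
  have := nc j b ltac:(lia) bj; lia.
have bsb : b \in porbit s (s b) by rewrite porbit_sym mem_porbit1.
have [j jo /andP[jb bj]] := porbit_step bsb (c := pos (s a)) ltac:(lia).
have job : j \in porbit s b by apply: porbit_trans jo; exact: mem_porbit1.
have sjb : pos (s j) <= pos b.
  have h' : pos (s b) <= pos b by lia.
  have := inc b (s j) h'; rewrite perm_in_porbit => /(_ job); lia.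
have [g go /andP[gb bg]] := porbit_step ao (c := pos (s j)) ltac:(lia).
have jsa : pos j != pos (s a).
  apply: contraNneq bo => /pos_inj e; rewrite porbit_sym -perm_in_porbit -e -porbit_sym.
  by rewrite porbit_sym.
have gsj : pos g != pos (s j).
  apply: contraNneq bo => /pos_inj e; rewrite e perm_in_porbit in go.
  rewrite porbit_sym in job; apply: porbit_trans job.
  by apply: porbit_trans go; exact: mem_porbit1.
have sg := so g go; have := nc j g ltac:(lia) ltac:(lia); lia.
Qed.

(** By [incr_gap] the image of a point is the next larger element of its orbit, or the least one if
    the point is the top. *)
Lemma incr_ext x y : incr x -> incr y ->
  (forall t u, (u \in porbit x t) = (u \in porbit y t)) -> x = y.
Proof.
move=> ix iy e; apply/permP => t; apply: pos_inj; apply/eqP; rewrite eqn_leq.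
have xy : x t \in porbit y t by rewrite -e mem_porbit1.
have yx : y t \in porbit x t by rewrite e mem_porbit1.
have [xd|xd] := leqP (pos (x t)) (pos t); have [yd|yd] := leqP (pos (y t)) (pos t).
- by have := ix _ _ xd yx; have := iy _ _ yd xy; lia.
- by have := ix _ _ xd yx; lia.
- by have := iy _ _ yd xy; lia.
- by rewrite (incr_gap ix yx yd) (incr_gap iy xy xd).
Qed.

(** * Quotients of an increasing permutation *)

Section Quotient.
Variables x y : {perm T}.
Hypotheses (iy : incr y) (xy : forall t, x t \in porbit y t).

(** The quotient sends [x t] to [y t], so this locates its weak descents. Above [t], the lowest
    element of the orbit is [y t]; at the top, [y t] is the least element of all. *)
Lemma quotient_wdesE t : (pos (y t) <= pos (x t)) =
  (pos t < pos (x t)) || (t \in wdes y).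
Proof.
rewrite inE; have [yd|yd] := leqP (pos (y t)) (pos t).
  by rewrite orbT; have := iy yd (xy t); lia.
rewrite orbF; apply/idP/idP => [|h]; [lia | exact: incr_gap (xy t) h].
Qed.

Lemma card_wdes_quotient : #|wdes x| + #|wdes (x^-1 * y)%g| = #|T| + #|wdes y|.
Proof.
have -> : wdes (x^-1 * y)%g = x @: ((~: wdes x) :|: wdes y).
  apply/setP => t; rewrite -[t](permKV x); set u := (x^-1 t)%g.
  rewrite mem_imset; last exact: perm_inj.
  by rewrite !inE permM permK quotient_wdesE inE -ltnNge.
rewrite card_imset; last exact: perm_inj.
have -> : #|~: wdes x :|: wdes y| = #|~: wdes x| + #|wdes y|.
  (* The union is disjoint: a weak descent of [y] is the top of its orbit, which [x] cannot
     raise. *)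
  have := cardsUI (~: wdes x) (wdes y); suff -> : ~: wdes x :&: wdes y = finset.set0.
    by rewrite cards0 addn0.
  apply/setP => t; rewrite !inE; apply/negP => /andP[h1 h2].
  by have := iy h2 (xy t); lia.
by rewrite addnA cardsC.
Qed.

Lemma incr_quotient : incr x -> nocross x -> incr (x^-1 * y)%g.
Proof.
move=> ix nx t0 u; rewrite -[t0](permKV x); set i := (x^-1 t0)%g.
have E : (x^-1 * y)%g (x i) = y i by rewrite permM permK.
rewrite E => le uo.
(* The orbit of the weak descent [x i] is trapped in [A], which is closed under the quotient. *)
pose A := [pred z | (z \in porbit y i) && (pos (y i) <= pos z <= pos (x i))].
suff /andP[_ ->] : A u by [].
apply: porbit_closed uo => [z|]; last by rewrite /= xy le leqnn.
rewrite -[z](permKV x); set e := (x^-1 z)%g => /= /andP[zo zi].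
have -> : (x^-1 * y)%g (x e) = y e by rewrite permM permK.
have eo : e \in porbit y i.
  by apply: porbit_trans zo _; rewrite porbit_sym.
rewrite perm_in_porbit eo /=.
have [ei|ei] := eqVneq (pos e) (pos i); first by rewrite (pos_inj ei) leqnn le.
have xei : pos (x e) != pos (x i) by apply: contraNneq ei => /pos_inj/perm_inj->.
have cl : e \in porbit x (x e) by rewrite porbit_sym mem_porbit1.
(* First case: [i] is the top of its [y]-orbit. By [nocross_down], [e] in the span from [x i] to [i]
   would put [x e] there too, although [x e] is below [x i]; hence [e] is below [x i]. *)
have [yd|yd] := leqP (pos (y i)) (pos i).
  have h1 := iy yd (xy i); have h2 := iy yd eo.
  have h3 : ~~ (pos (x i) <= pos e <= pos i).
    apply/negP => /(nocross_down ix nx _); lia.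
  have yeo : y e \in porbit y i by rewrite perm_in_porbit.
  have h4 := iy yd yeo.
  have : pos (y e) <= pos (x i).
    apply: incr_gap => //; last lia.
    by rewrite porbit_sym in eo; exact: porbit_trans eo (xy i).
  lia.
(* Second case: [i] ascends under both [y] and [x], and [nocross_up] confines the [x]-orbit of
   [x e], hence [e], to the arc from [i] to [x i]. *)
have ixi : pos i < pos (x i) by lia.
have ieo : pos i < pos e < pos (x i).
  apply: (@porbit_closed _ x [pred a | pos i < pos a < pos (x i)] _ _ _ _ cl) => [v|/=].
    exact: nocross_up.
  by lia.
have xio : x i \in porbit y e.
  by rewrite porbit_sym in eo; exact: porbit_trans eo (xy i).
have h1 : pos (y e) <= pos (x i) by apply: incr_gap => //; lia.
have h2 : pos e < pos (y e).
  rewrite ltnNge; apply/negP => h; have := iy h xio; lia.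
have : pos (y i) <= pos e by apply: incr_gap => //; lia.
lia.
Qed.

End Quotient.

(** * The cycle to the next point *)

Section LongCycle.
Variables (c : {perm T}) (top : T).
Hypotheses (c_top : forall t, pos (c top) <= pos t)
  (top_max : forall t, pos t <= pos top)
  (c_succ : forall t, t != top -> pos (c t) = (pos t).+1).

Lemma wdes_cycle : wdes c = [set top].
Proof.
apply/setP => t; rewrite !inE; have [->|/c_succ->] := eqVneq; first exact: c_top.
by rewrite ltnn.
Qed.

Lemma incr_cycle : incr c.
Proof.
move=> t u td _; have : t \in wdes c by rewrite inE.
by rewrite wdes_cycle inE => /eqP->; rewrite c_top top_max.
Qed.

Lemma mem_porbit_cycle t u : u \in porbit c t.
Proof.
suff h v : v \in porbit c (c top).
  by have := h t; rewrite porbit_sym => /porbit_trans; apply.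
have [n le] := ubnP (pos v); elim: n v le => // n IH v le.
have e : c (c^-1 v)%g = v by rewrite permKV.
have [vt|nt] := eqVneq (c^-1 v)%g top; first by rewrite -e vt porbit_id.
by rewrite -e perm_in_porbit IH //; move: (c_succ nt); rewrite e; lia.
Qed.

Lemma ncyc_cycle : ncyc c = 1.
Proof.
suff : porbits c = [set finset.setT] by rewrite /ncyc => ->; rewrite cards1.
apply/setP => O; rewrite inE; apply/imsetP/eqP => [[t _ ->]|->].
  by apply/setP => u; rewrite inE mem_porbit_cycle.
by exists top => //; apply/setP => u; rewrite inE mem_porbit_cycle.
Qed.

(** Induction on [x a]. Given a crossing, the quotient cycle of [x a] spans [c a] to [x a] and jumps
    over [b], which yields [e] above [b] with [x e] at or below [b]. Climbing from [x e] back to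
    [e], the [x]-cycle jumps over [b] from some [f], and [f], [b] cross with [x f] below [x a]. *)
Lemma nocross_cycle x : incr x -> incr (x^-1 * c)%g -> nocross x.
Proof.
move=> ix ik a b; have [n le] := ubnP (pos (x a)); elim: n a le => // n IH a le ab ba.
rewrite leqNgt; apply/negP => ba2.
have E t : (x^-1 * c)%g (x t) = c t by rewrite permM permK.
have sa : pos (c a) = (pos a).+1.
  by apply: c_succ; apply: contraTneq ab => ->; rewrite -leqNgt top_max.
have ka : pos ((x^-1 * c)%g (x a)) <= pos (x a) by rewrite E sa; lia.
have xo : x a \in porbit (x^-1 * c)%g (c a).
  by rewrite porbit_sym -E mem_porbit1.
have [v vo] := porbit_step xo (c := pos b) ltac:(lia).
have {}vo : v \in porbit (x^-1 * c)%g (x a).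
  by apply: porbit_trans vo; rewrite porbit_sym.
have h1 := ik _ _ ka vo.
have := ik _ ((x^-1 * c)%g v) ka; rewrite perm_in_porbit => /(_ vo).
rewrite -[v](permKV x) in h1 *; set e := (x^-1 v)%g in h1 *.
rewrite !E sa in h1 * => h2 /andP[h3 h4].
have se : pos (c e) = (pos e).+1.
  by apply: c_succ; apply: contraTneq h4 => ->; rewrite -leqNgt c_top.
have eb : pos e != pos b by apply: contraTneq ba2 => /pos_inj <-; lia.
have bo : b \notin porbit x e.
  apply/negP => bo; have := ix e (x b) ltac:(lia); rewrite perm_in_porbit => /(_ bo); lia.
have eo : e \in porbit x (x e) by rewrite porbit_sym mem_porbit1.
have [f fo /andP[fb bf]] := porbit_step eo (c := pos b) ltac:(lia).
have {}fo : f \in porbit x e by apply: porbit_trans fo; exact: mem_porbit1.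
have xf := ix e (x f) ltac:(lia); rewrite perm_in_porbit in xf; have {}xf := xf fo.
have fb' : pos f != pos b by apply: contraNneq bo => /pos_inj <-.
have := IH f ltac:(lia) ltac:(lia) bf; lia.
Qed.

End LongCycle.
End Increasing.

(** * Length and block sums *)

(* Elaborating {perm 'I_d} leaves a reverse_coercion that keeps lia from
   identifying equal atoms. *)
Ltac rlia := unfold reverse_coercion in *; lia.

Section Length.
Variable d : nat.
Implicit Types (a b h : {perm 'I_d}) (xs : seq {perm 'I_d}).

Lemma cprod_tprod (ts : seq ('I_d * 'I_d)) :
  cprod [seq tperm p.1 p.2 | p <- ts] = tprod (rev ts).
Proof. by rewrite /cprod -map_rev big_map. Qed.

Lemma cprod_nil : cprod [::] = 1%g :> {perm 'I_d}.
Proof. by rewrite /cprod big_nil. Qed.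

Lemma cprod_cons a xs : cprod (a :: xs) = (cprod xs * a)%g.
Proof. by rewrite /cprod rev_cons big_rcons. Qed.

Lemma cprod_cat xs ys : cprod (xs ++ ys) = (cprod ys * cprod xs)%g :> {perm 'I_d}.
Proof. by rewrite /cprod rev_cat big_cat. Qed.

Lemma ell_ncyc h : ell h + ncyc h = d.
Proof.
rewrite /ell; case: ex_minnP => m /existsP[ts /andP[_ /eqP e]] mmin.
have lo := tprod_porbits (rev ts).
rewrite -cprod_tprod -e size_rev size_tuple card_ord in lo.
have [ts' [ts'h ts'ne] ts's] := tprod_exists h.
rewrite card_ord in ts's.
suff : m <= size ts' by rlia.
apply: mmin; rewrite -(size_rev ts'); apply/existsP; exists (in_tuple (rev ts')).
by rewrite /= all_rev ts'ne cprod_tprod revK ts'h /=.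
Qed.

Lemma ell_eq a b : ncyc a = ncyc b -> ell a = ell b.
Proof. by have := ell_ncyc a; have := ell_ncyc b; rlia. Qed.

Lemma ell1 : ell (1 : {perm 'I_d})%g = 0.
Proof. by have := ell_ncyc 1%g; rewrite ncyc1 card_ord; rlia. Qed.

Lemma ellJ a b : ell (a ^ b)%g = ell a.
Proof. by apply: ell_eq; exact: ncycJ. Qed.

Lemma ellM a b : ell (a * b)%g <= ell a + ell b.
Proof.
have [s [<- _] es] := tprod_exists a; have [t [<- _] et] := tprod_exists b.
have := tprod_porbits (s ++ t); rewrite tprod_cat size_cat.
have := ell_ncyc (tprod s * tprod t)%g.
by have := ell_ncyc (tprod s); have := ell_ncyc (tprod t); rewrite card_ord in es et *; rlia.
Qed.

(** Minimal words of the factors concatenate to a minimal word of the product, to which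
    [tprod_minimal] applies. *)
Lemma ell_additive_porbit a b t : ell (a * b)%g = ell a + ell b ->
  a t \in porbit (a * b)%g t /\ b t \in porbit (a * b)%g t.
Proof.
have [r [ra _] er] := tprod_exists a; have [s [sb _] es] := tprod_exists b.
rewrite -ra -sb -tprod_cat card_ord in er es * => e.
have := ell_ncyc (tprod (r ++ s)); have := ell_ncyc (tprod r); have := ell_ncyc (tprod s).
move=> e1 e2 e3.
have mn : size (r ++ s) + ncyc (tprod (r ++ s)) = #|'I_d|.
  by rewrite card_ord size_cat; rlia.
have H := tprod_minimal mn.
by split; apply: tprod_sub => p pr; apply: H; rewrite mem_cat pr ?orbT.
Qed.

Lemma ell_cprod xs : ell (cprod xs) <= sumn (map (@ell d) xs).
Proof.
elim: xs => [|a xs IH]; first by rewrite cprod_nil ell1.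
by rewrite cprod_cons /=; have := ellM (cprod xs) a; rlia.
Qed.

Lemma absle_porbit a b t : absle a b -> a t \in porbit b t.
Proof.
rewrite /absle /comp => /eqP e.
have : ell (b * a^-1 * a)%g = ell (b * a^-1)%g + ell a by rewrite mulgVK; rlia.
by move=> /(ell_additive_porbit t)[_]; rewrite mulgVK.
Qed.

Lemma abslexx a : absle a a.
Proof. by rewrite /absle /comp mulgV ell1 addn0. Qed.

Lemma absleJ a b c : absle (a ^ c)%g (b ^ c)%g = absle a b.
Proof. by rewrite /absle /comp -conjVg -conjMg !ellJ. Qed.

Lemma absle_ncyc a b : absle a b = (ncyc a + ncyc (a^-1 * b)%g == d + ncyc b).
Proof.
rewrite /absle /comp.
have -> : ell (b * a^-1)%g = ell (a^-1 * b)%g.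
  by rewrite -(ellJ _ a) conjgE !mulgA mulgVK.
by have := ell_ncyc a; have := ell_ncyc b; have := ell_ncyc (a^-1 * b)%g; rlia.
Qed.

End Length.

Lemma sum_eq_pointwise (I : eqType) (s : seq I) (F G : I -> nat) :
  (forall i, F i <= G i) -> \sum_(i <- s) F i = \sum_(i <- s) G i ->
  forall i, i \in s -> F i = G i.
Proof.
move=> le; elim: s => [//|a s IH]; rewrite !big_cons => e i.
have h : \sum_(j <- s) F j <= \sum_(j <- s) G j by apply: leq_sum.
by have lea := le a; rewrite inE => /orP[/eqP->|]; [lia | apply: IH; lia].
Qed.

(** * Sheets and levels: the direct sum of the factors and its quotient *)

Section BlockSum.
Variables (d K : nat).
Local Notation T := ('I_d * 'I_K)%type.
Implicit Types (t u : T) (m : 'I_d) (j : 'I_K).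

Definition lpos t : nat := t.1 * K + t.2.

Lemma lpos_lt t u : (lpos t < lpos u) =
  (t.1 < u.1) || (t.1 == u.1) && (t.2 < u.2).
Proof.
case: t u => [m j] [m' j']; rewrite /lpos /=; have := ltn_ord j; have := ltn_ord j'.
have [->|ne] := eqVneq m m'; first by rewrite ltnn /= ltn_add2l.
have {ne} : (m != m' :> nat) by []. rewrite orbF; nia.
Qed.

Lemma lpos_inj : injective lpos.
Proof.
move=> t u e; have := lpos_lt t u; have := lpos_lt u t; rewrite e ltnn.
move: t u {e} => [m j] [m' j'] /=.
have [->|ne] := eqVneq m m'; last by have {ne} : (m != m' :> nat) by []; lia.
by move=> h1 h2; congr (_, _); apply: val_inj => /=; lia.
Qed.

Hypotheses (d_gt0 : 0 < d) (K_gt0 : 0 < K).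

Definition lsucc_fun t : T :=
  if insub t.2.+1 is Some j then (t.1, j) else (delta d t.1, Ordinal K_gt0).

Lemma lsucc_fun_lt m j (h : j.+1 < K) : lsucc_fun (m, j) = (m, Ordinal h).
Proof. by rewrite /lsucc_fun /= insubT. Qed.

Lemma lsucc_fun_ge m j : K <= j.+1 -> lsucc_fun (m, j) = (delta d m, Ordinal K_gt0).
Proof. by move=> h; rewrite /lsucc_fun /= insubF // ltnNge h. Qed.

Lemma lsucc_inj : injective lsucc_fun.
Proof.
move=> [m j] [m' j']; have [h|h] := ltnP j.+1 K; have [h'|h'] := ltnP j'.+1 K.
- by rewrite !lsucc_fun_lt => -[-> e]; congr (_, _); apply: val_inj.
- by rewrite lsucc_fun_lt lsucc_fun_ge // => -[].
- by rewrite lsucc_fun_ge // lsucc_fun_lt => -[].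
rewrite !lsucc_fun_ge // => -[/perm_inj->]; congr (_, _); apply: val_inj => /=.
by have := ltn_ord j; have := ltn_ord j'; lia.
Qed.

Definition lsucc : {perm T} := perm lsucc_inj.

Lemma lpos_top_proof : (d.-1 < d) /\ (K.-1 < K).
Proof. by lia. Qed.

Definition ltop : T := (Ordinal lpos_top_proof.1, Ordinal lpos_top_proof.2).

Lemma delta_val m : delta d m = m.+1 %% d :> nat.
Proof. by rewrite permE. Qed.

Lemma lsucc_top t : lpos (lsucc ltop) <= lpos t.
Proof.
rewrite permE lsucc_fun_ge /=; last lia.
by rewrite /lpos /= delta_val /= prednK // modnn.
Qed.

Lemma ltop_max t : lpos t <= lpos ltop.
Proof.
case: t => m j; rewrite leqNgt lpos_lt /=; have := ltn_ord m; have := ltn_ord j.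
lia.
Qed.

Lemma lsucc_succ t : t != ltop -> lpos (lsucc t) = (lpos t).+1.
Proof.
case: t => m j nt; rewrite permE; have [h|h] := ltnP j.+1 K.
  by rewrite lsucc_fun_lt /lpos /= addnS.
rewrite lsucc_fun_ge // /lpos /= delta_val addn0.
have jK : j = K.-1 :> nat by have := ltn_ord j; lia.
have mt : m.+1 < d.
  rewrite ltn_neqAle ltn_ord andbT; apply: contra nt => /eqP e.
  by apply/eqP; congr (_, _); apply: val_inj => /=; lia.
rewrite modn_small //; nia.
Qed.

Variable xs : seq {perm 'I_d}.
Hypothesis xsK : size xs = K.

Definition lsum_fun t : T := (nth 1%g xs t.2 t.1, t.2).

Lemma lsum_inj : injective lsum_fun.
Proof. by move=> [m j] [m' j'] [+ e]; rewrite /= e => /perm_inj->. Qed.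

Definition lsum : {perm T} := perm lsum_inj.

Lemma lsumE m j : lsum (m, j) = (nth 1%g xs j m, j).
Proof. by rewrite permE. Qed.

Lemma lsumV m j : (lsum^-1)%g (m, j) = ((nth 1%g xs j)^-1%g m, j).
Proof. by apply: (@perm_inj _ lsum); rewrite permKV lsumE permKV. Qed.

Lemma mem_porbit_lsum m j u :
  (u \in porbit lsum (m, j)) = (u.1 \in porbit (nth 1%g xs j) m) && (u.2 == j).
Proof.
have e i : (lsum ^+ i)%g (m, j) = ((nth 1%g xs j ^+ i)%g m, j).
  by elim: i => [|i IH]; rewrite ?expg0 ?perm1 // !expgSr !permM IH lsumE.
apply/porbitP/andP => [[i ->]|[/porbitP[i ui] /eqP uj]].
  by rewrite e /= mem_porbit.
by exists i; rewrite e -ui -uj; case: u {ui uj}.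
Qed.

Definition lquot : {perm T} := (lsum^-1 * lsucc)%g.

(* The sheet-0 point at which the orbit of t under lquot next enters. *)
Definition lret t : 'I_d := delta d ((cprod (drop t.2 xs))^-1%g t.1).

Lemma lquot_lt m j (h : j.+1 < K) :
  lquot (m, j) = ((nth 1%g xs j)^-1%g m, Ordinal h).
Proof. by rewrite permM lsumV permE lsucc_fun_lt. Qed.

Lemma lret_lt m j (h : j.+1 < K) : lret (lquot (m, j)) = lret (m, j).
Proof.
rewrite lquot_lt /lret /= [drop j xs](drop_nth 1%g) ?xsK //.
by rewrite cprod_cons invMg permM.
Qed.

Lemma lquot_ge m j : K <= j.+1 -> lquot (m, j) = (lret (m, j), Ordinal K_gt0).
Proof.
move=> h; rewrite permM lsumV permE lsucc_fun_ge // /lret /=.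
rewrite [drop j xs](drop_nth 1%g) ?xsK // drop_oversize ?xsK //.
by rewrite cprod_cons cprod_nil mul1g.
Qed.

(** The first return map of [lquot] to level 0. It is conjugate to [comp h^-1 (delta d)] for the
    product [h] of the factors. *)
Definition lmono : {perm 'I_d} := ((cprod xs)^-1 * delta d)%g.

Lemma lret0 m : lret (m, Ordinal K_gt0) = lmono m.
Proof. by rewrite /lret /= drop0 permM. Qed.

Lemma lret_orbit t : (lret t, Ordinal K_gt0) \in porbit lquot t.
Proof.
have [n le] := ubnP (K - t.2); elim: n t le => // n IH [m j] le.
have [h|h] := ltnP j.+1 K; last by rewrite -lquot_ge // mem_porbit1.
rewrite -(lret_lt m h); apply: porbit_trans (mem_porbit1 _ _) _.
by apply: IH; rewrite lquot_lt /=; rewrite /= in le; lia.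
Qed.

(** Along [lquot], [lret] is constant while the level rises and advances by [lmono] at the
    wrap-around. Conversely, every orbit of [lquot] meets level 0. *)
Lemma ncyc_lquot : ncyc lquot = ncyc lmono.
Proof.
apply: (@ncyc_semiconj _ _ lret) => [m|t u].
  by exists (lmono^-1%g m, Ordinal K_gt0); rewrite lret0 permKV.
apply/idP/idP => [|ur].
  apply: (@porbit_closed _ _ [pred u | lret u \in porbit lmono (lret t)]) => [[m j]|] /=.
    have [h|h] := ltnP j.+1 K; first by rewrite lret_lt.
    by rewrite lquot_ge // lret0 perm_in_porbit.
  exact: porbit_id.
apply: (@porbit_trans _ _ _ (lret t, Ordinal K_gt0)); first exact: lret_orbit.
suff h : (lret u, Ordinal K_gt0) \in porbit lquot (lret t, Ordinal K_gt0).
  by apply: porbit_trans h _; rewrite porbit_sym lret_orbit.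
apply: (@porbit_closed _ lmono
  [pred m | (m, Ordinal K_gt0) \in porbit lquot (lret t, Ordinal K_gt0)] _ _ _ _ ur) => [m /=|].
  by move=> h; apply: porbit_trans h _; rewrite -lret0 lret_orbit.
exact: porbit_id.
Qed.

Lemma card_wdes_lsum :
  #|wdes lpos lsum| = \sum_(x <- xs) #|wdes (@nat_of_ord d) x|.
Proof.
rewrite (big_nth 1%g) big_mkord xsK -sum1_card big_mkcond.
transitivity (\sum_(j < K) \sum_(m < d)
    if (m, j) \in wdes lpos lsum then 1 else 0).
  rewrite exchange_big pair_bigA; apply: eq_bigr => -[m j] _ //.
apply: eq_bigr => j _; rewrite -sum1_card [RHS]big_mkcond; apply: eq_bigr => m _.
by rewrite !inE lsumE /lpos /= leq_add2r leq_pmul2r.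
Qed.

Lemma incr_lsum : (forall x, x \in xs -> incr (@nat_of_ord d) x) -> incr lpos lsum.
Proof.
move=> h [m j] u; have xj : nth 1%g xs j \in xs by rewrite mem_nth ?xsK.
rewrite mem_porbit_lsum lsumE /lpos /= leq_add2r leq_pmul2r // => md /andP[um /eqP->].
by rewrite !leq_add2r !leq_pmul2r //; exact: (h _ xj _ _ md um).
Qed.

(* Genus zero: the numbers of cycles of lsum and lquot add up to dK + 1. *)
Definition genus0 := sumn (map (@ell d) xs) + ell lmono == d.-1.

Lemma lincr_cycle : incr lpos lsucc.
Proof. by exact: (incr_cycle lsucc_top ltop_max lsucc_succ). Qed.

Lemma lmem_cycle t : lsum t \in porbit lsucc t.
Proof. by exact: (mem_porbit_cycle lsucc_succ). Qed.

Lemma sum_ell : sumn (map (@ell d) xs) + \sum_(x <- xs) ncyc x = d * K.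
Proof.
rewrite sumnE big_map -big_split /= (eq_bigr (fun=> d)) => [|x _]; last exact: ell_ncyc.
by rewrite big_const_seq count_predT xsK iter_addn_0.
Qed.

Lemma wdes_lsum_lquot : #|wdes lpos lsum| + #|wdes lpos lquot| = d * K + 1.
Proof.
rewrite (card_wdes_quotient lpos_inj lincr_cycle lmem_cycle) card_prod !card_ord.
by rewrite (wdes_cycle lsucc_top lsucc_succ) cards1.
Qed.

(** Cycles and weak descents now have the same total dK + 1. As no permutation has more cycles than
    weak descents, equality holds for every summand and for [lquot]. *)
Lemma genus0_nocross : genus0 ->
  (forall x, x \in xs -> incr (@nat_of_ord d) x) /\ nocross lpos lsum.
Proof.
rewrite /genus0 => /eqP ad; have e := sum_ell; have em := ell_ncyc lmono.
have := wdes_lsum_lquot; rewrite card_wdes_lsum => w.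
have le x : ncyc x <= #|wdes (@nat_of_ord d) x| := ncyc_wdes _ x.
have lq := ncyc_wdes lpos lquot; rewrite ncyc_lquot in lq.
have sle : \sum_(x <- xs) ncyc x <= \sum_(x <- xs) #|wdes (@nat_of_ord d) x|.
  by apply: leq_sum => x _.
have sE : \sum_(x <- xs) ncyc x = \sum_(x <- xs) #|wdes (@nat_of_ord d) x| by rlia.
have inc x : x \in xs -> incr (@nat_of_ord d) x.
  move=> xin; apply/incrP; first exact: val_inj.
  exact: sum_eq_pointwise sE _ xin.
split=> //; apply: (nocross_cycle lpos_inj lsucc_top ltop_max lsucc_succ).
  exact: incr_lsum.
by apply/(incrP lpos_inj); rewrite -/lquot ncyc_lquot; rlia.
Qed.

Lemma nocross_genus0 :
  (forall x, x \in xs -> incr (@nat_of_ord d) x) -> nocross lpos lsum -> genus0.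
Proof.
move=> inc nc; rewrite /genus0; have e := sum_ell; have em := ell_ncyc lmono.
have := wdes_lsum_lquot; rewrite card_wdes_lsum => w.
have : ncyc lquot = #|wdes lpos lquot|.
  apply/(incrP lpos_inj); apply: incr_quotient => //.
  - exact: lpos_inj.
  - exact: lincr_cycle.
  - exact: lmem_cycle.
  - exact: incr_lsum.
rewrite ncyc_lquot => lq.
have sE : \sum_(x <- xs) ncyc x = \sum_(x <- xs) #|wdes (@nat_of_ord d) x|.
  apply: eq_big_seq => x xin; apply/incrP; [exact: val_inj|exact: inc].
rlia.
Qed.

End BlockSum.

(** * Weighted factorizations on a grid of levels *)

(** Since [x], [y] and their quotient are all increasing, [card_wdes_quotient] becomes the cycle
    count that expresses the order. *)
Lemma absle_of_porbit d (x y : {perm 'I_d}) :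
  incr (@nat_of_ord d) x -> nocross (@nat_of_ord d) x -> incr (@nat_of_ord d) y ->
  (forall t, x t \in porbit y t) -> absle x y.
Proof.
move=> ix nx iy xy; rewrite absle_ncyc.
have vi : injective (@nat_of_ord d) := @ord_inj d.
have iq := incr_quotient vi iy xy ix nx.
have := card_wdes_quotient vi iy xy; rewrite card_ord.
by rewrite -(proj1 (incrP vi _) ix) -(proj1 (incrP vi _) iy) -(proj1 (incrP vi _) iq) => ->.
Qed.

Lemma ell_delta d : 0 < d -> ell (delta d) = d.-1.
Proof.
move=> d0; have h := ell_ncyc (delta d); suff : ncyc (delta d) = 1 by rlia.
have tp : d.-1 < d by lia.
apply: (@ncyc_cycle _ (@nat_of_ord d) _ (Ordinal tp)) => // t tn.
rewrite delta_val modn_small //; have := ltn_ord t.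
have : t != d.-1 :> nat by apply: contraNneq tn => e; apply/eqP/val_inj.
lia.
Qed.

Lemma ell_lmono d (h : {perm 'I_d}) : ell (h^-1 * delta d)%g = ell (comp h^-1 (delta d)).
Proof. by rewrite /comp -(ellJ _ h^-1) conjgE invgK !mulgA mulgV mul1g. Qed.

Lemma absle_delta d (h : {perm 'I_d}) : 0 < d ->
  absle h (delta d) = (ell h + ell (h^-1 * delta d)%g == d.-1).
Proof. by move=> d0; rewrite /absle ell_delta // ell_lmono. Qed.

Section Levels.
Variables (R : realType) (d : nat).
Hypothesis d_gt0 : 0 < d.
Local Notation Sd := {perm 'I_d}.
Local Open Scope ring_scope.
Implicit Types (u v w : R -> Sd) (s l : seq R).

Lemma interior_support_uniq u v s l : interior_support u s -> interior_support v l ->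
  (forall r, 0 < r < 1 -> u r = v r) -> s = l.
Proof.
move=> [ss [s1 s2]] [sl [l1 l2]] uv; apply: lt_sorted_eq => // r.
apply/idP/idP => h; have r01 : 0 < r < 1 by [exact: s1|exact: l1|].
  by rewrite -l2 // -uv // s2.
by rewrite -s2 // uv // l2.
Qed.

Lemma FI_genus0 u : FI (delta d) u -> exists2 s, interior_support u s &
  genus0 (u 0 :: map u s ++ [:: u 1]).
Proof.
move=> [h [hd [_ [s [us [e1 e2]]]]]]; exists s => //.
by rewrite /genus0 e1 /lmono e2 -absle_delta.
Qed.

(** The total length of the factors is at least [ell h], and [ell h] plus the length of the
    complement is at least [d.-1]. Genus zero makes both bounds sharp: the factorization is minimal
    and [h] lies below [delta d]. *)
Lemma genus0_FI u s : multI u -> interior_support u s ->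
  genus0 (u 0 :: map u s ++ [:: u 1]) -> FI (delta d) u.
Proof.
rewrite /genus0 /lmono; set xs := (u 0 :: _); set h := cprod xs => mu us /eqP e.
have hs : (ell h <= sumn (map (@ell d) xs))%N := ell_cprod xs.
have hd : (ell (delta d) <= ell h + ell (h^-1 * delta d)%g)%N.
  by rewrite -{1}[delta d](mulKVg h); exact: ellM.
rewrite ell_delta // in hd.
have hE : sumn (map (@ell d) xs) = ell h by rlia.
exists h; split; first by rewrite absle_delta // -hE; apply/eqP.
by split=> //; exists s.
Qed.

(** Level 0 is always present and trivial factors are allowed, so that any finite set of levels can
    be adjoined. *)
Definition grid l := sorted <%R (0 :: l) /\ forall r, r \in l -> r < 1.

Lemma grid_exists s : exists l, grid l /\ forall r, (r \in l) = (r \in s) && (0 < r < 1).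
Proof.
pose l := sort <=%R (undup [seq r <- s | 0 < r < 1]).
have lE r : (r \in l) = (r \in s) && (0 < r < 1).
  by rewrite mem_sort mem_undup mem_filter andbC.
exists l; split=> //; split=> [|r]; last by rewrite lE => /andP[_ /andP[]].
rewrite /= lt_path_sortedE; apply/andP; split.
  by apply/allP => r; rewrite lE => /andP[_ /andP[]].
by rewrite sort_lt_sorted undup_uniq.
Qed.

Lemma grid_range l r : grid l -> r \in 0 :: l -> 0 <= r < 1.
Proof.
move=> [sl l1]; rewrite inE => /orP[/eqP->|rl]; first by rewrite lexx ltr01.
by rewrite l1 //; move: sl; rewrite /= lt_path_sortedE => /andP[/allP/(_ _ rl)/ltW->].
Qed.

Lemma drop_trivial w s : let s' := [seq r <- s | w r != 1%g] in
  sumn (map (@ell d) (map w s')) = sumn (map (@ell d) (map w s)) /\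
  cprod (map w s') = cprod (map w s).
Proof.
elim: s => //= r s [e1 e2]; have [wr|wr] := eqVneq (w r) 1%g => /=.
  by rewrite cprod_cons wr ell1 mulg1.
by rewrite !cprod_cons e1 e2.
Qed.

(** Trivial factors change neither the total length nor the product, so any grid covering the
    support may replace the support itself. *)
Lemma FS_genus0 w l : multS w -> grid l -> (forall r, w r != 1%g -> r \in 0 :: l) ->
  FS (delta d) w <-> genus0 (map w (0 :: l)).
Proof.
move=> mw gl wl.
have toIw : toI w = w.
  apply: funext => r; rewrite /toI; case: ifP => // h; apply/esym/eqP.
  by apply: contraFT h => /(proj1 mw).
have w1 : w 1 = 1%g.
  by apply/eqP; apply: contraT => /(proj1 mw); rewrite ltxx andbF.
set s := [seq r <- l | w r != 1%g].
have sw : interior_support w s.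
  have := gl; rewrite /grid /= lt_path_sortedE => -[/andP[/allP l0 sl] l1].
  split; first by apply: sorted_filter => //; exact: lt_trans.
  split=> r; first by rewrite mem_filter => /andP[_ h]; rewrite l0 ?l1.
  move=> /andP[r0 _]; rewrite mem_filter; apply/idP/andP => [h|[]//]; split=> //.
  by have := wl _ h; rewrite inE gt_eqF.
have [e1 e2] := drop_trivial w l.
have E : genus0 (w 0 :: map w s ++ [:: w 1]) = genus0 (map w (0 :: l)).
  rewrite /genus0 /lmono /= !cprod_cons cprod_cat cprod_cons cprod_nil w1.
  by rewrite !mul1g map_cat sumn_cat /= ell1 !addn0 e1 e2.
rewrite -E; split=> [[_ ]|h].
  rewrite toIw => /FI_genus0[s' ws']; have -> // := interior_support_uniq sw ws'.
split=> //; rewrite toIw; apply: genus0_FI h => //.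
split; last exact: (proj2 mw).
by move=> r /(proj1 mw)/andP[-> /ltW].
Qed.

Variable l : seq R.
Hypothesis gl : grid l.
Local Notation K := (size (0%R :: l)).

Definition lvl (j : 'I_K) : R := nth 0 (0 :: l) j.

Lemma lvl_range j : 0 <= lvl j < 1.
Proof. by apply: (grid_range gl); rewrite mem_nth. Qed.

Lemma lvl_onto r : r \in 0 :: l -> exists j, lvl j = r.
Proof.
move=> rl; rewrite -index_mem in rl; exists (Ordinal rl).
by rewrite /lvl nth_index // -index_mem.
Qed.

Lemma lvl_lt i j : (lvl i < lvl j) = (i < j)%N.
Proof. by rewrite /lvl lt_sorted_ltn_nth ?inE //; case: gl. Qed.

Lemma lvl_inj : injective lvl.
Proof.
move=> i j e; have := lvl_lt i j; have := lvl_lt j i; rewrite e ltxx => h1 h2.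
by apply: ord_inj; case: ltngtP h1 h2.
Qed.

Definition theta (t : 'I_d * 'I_K) : R := lvl t.2 + (t.1)%:R.

Lemma theta_lt (t u : 'I_d * 'I_K) : (theta t < theta u) = (lpos t < lpos u)%N.
Proof.
case: t u => [m i] [n j]; rewrite lpos_lt // /theta /=.
have := lvl_range i; have := lvl_range j.
have [->|ne] := eqVneq m n; first by rewrite ltnn ltrD2r lvl_lt.
have {ne} : (m != n :> nat) by [].
rewrite andFb orbF neq_ltn => /orP[h|h].
  have : (m.+1%:R <= n%:R :> R) by rewrite ler_nat.
  by rewrite h -natr1; lra.
have : (n.+1%:R <= m%:R :> R) by rewrite ler_nat.
by rewrite ltnNge (ltnW h) -natr1 /=; lra.
Qed.

End Levels.

(** * Chords and convex hulls on the circle *)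

Section Circle.
Variable R : realType.
Local Open Scope ring_scope.
Local Notation C := (R * R)%type.
Implicit Types (A B : C -> Prop) (p q : C) (a b t u : R).

Lemma conv_sub A B p : (forall q, A q -> B q) -> conv A p -> conv B p.
Proof.
move=> AB [n [c [q [c0 [c1 [Aq pE]]]]]]; exists n, c, q; do !split=> //.
by move=> i; exact: AB.
Qed.

(** * Affine forms and separating lines *)

Definition aff (k : R * R * R) p : R := k.1.1 * p.1 + k.1.2 * p.2 + k.2.

Lemma conv_aff k A p : conv A p ->
  exists n (c : 'I_n -> R) (q : 'I_n -> C), [/\ forall i, 0 <= c i, \sum_i c i = 1,
    forall i, A (q i) & aff k p = \sum_i c i * aff k (q i)].
Proof.
move=> [n [c [q [c0 [c1 [Aq ->]]]]]]; exists n, c, q; split=> //.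
have kE : \sum_i c i * k.2 = k.2 by rewrite -mulr_suml c1 mul1r.
rewrite /aff -[in LHS]kE /= !mulr_sumr -!big_split.
by apply: eq_bigr => i _ /=; ring.
Qed.

Lemma conv_aff_ge0 k A p : conv A p -> (forall q, A q -> 0 <= aff k q) -> 0 <= aff k p.
Proof.
move=> /(conv_aff k)[n [c [q [c0 _ Aq ->]]]] kA.
by apply: sumr_ge0 => i _; rewrite mulr_ge0 ?kA.
Qed.

Lemma conv_aff_gt0 k A p : conv A p -> (forall q, A q -> 0 < aff k q) -> 0 < aff k p.
Proof.
move=> /(conv_aff k)[n [c [q [c0 c1 Aq ->]]]] kA.
have ge i : 0 <= c i * aff k (q i) by rewrite mulr_ge0 // ltW // kA.
rewrite lt_neqAle sumr_ge0 // andbT eq_sym; apply/eqP => /psumr_eq0P s0.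
suff : (1 : R) = 0 by move/eqP; rewrite oner_eq0.
rewrite -c1 big1 // => i _; have /eqP := s0 (fun i _ => ge i) i isT.
by rewrite mulf_eq0 (gt_eqF (kA _ (Aq i))) orbF => /eqP.
Qed.

Lemma aff_opp k p : aff (- k.1.1, - k.1.2, - k.2) p = - aff k p.
Proof. by rewrite /aff /=; ring. Qed.

(** One inequality is weak because the separating line will pass through points of one of the two
    blocks. *)
Lemma conv_separated k A B p : conv A p -> conv B p ->
  (forall q, A q -> aff k q <= 0) -> (forall q, B q -> 0 < aff k q) -> False.
Proof.
move=> pA pB kA kB; have := conv_aff_gt0 pB kB; rewrite ltNge => /negP; apply.
rewrite -oppr_ge0 -aff_opp; apply: conv_aff_ge0 pA _ => q Aq.
by rewrite aff_opp oppr_ge0 kA.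
Qed.

Lemma conv_separatedN k A B p : conv A p -> conv B p ->
  (forall q, A q -> 0 <= aff k q) -> (forall q, B q -> aff k q < 0) -> False.
Proof.
move=> pA pB kA kB; apply: (conv_separated (k := (- k.1.1, - k.1.2, - k.2)) pA pB) => q h.
  by rewrite aff_opp oppr_le0 kA.
by rewrite aff_opp oppr_gt0 kB.
Qed.

Lemma sin_pi_gt0 t : 0 < t < 1 -> 0 < sin (pi * t).
Proof.
move=> /andP[t0 t1]; have p0 := pi_gt0 R.
by apply: sin_gt0_pi; rewrite mulr_gt0 //= -[ltRHS]mulr1 ltr_pM2l.
Qed.

(* The line through expi a and expi b, positive on the arc from a to b. *)
Definition chord a b : R * R * R :=
  (cos (pi * (a + b)), sin (pi * (a + b)), - cos (pi * (b - a))).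

Lemma chord_expi a b t :
  aff (chord a b) (expi t) = 2 * (sin (pi * (t - a)) * sin (pi * (b - t))).
Proof.
rewrite /aff /chord /expi /= -cosB.
have -> : pi * (a + b) - 2 * pi * t = pi * (b - t) - pi * (t - a) by ring.
have -> : pi * (b - a) = pi * (b - t) + pi * (t - a) by ring.
by rewrite cosB cosD; ring.
Qed.

Lemma chord_gt0 a b t : 0 <= a -> b < 1 -> a < t < b -> 0 < aff (chord a b) (expi t).
Proof.
move=> a0 b1 /andP[at_ tb]; rewrite chord_expi !mulr_gt0 ?sin_pi_gt0 //; lra.
Qed.

Lemma chord_lt0 a b t : 0 <= a -> a <= b -> b < 1 -> 0 <= t < 1 -> ~~ (a <= t <= b) ->
  aff (chord a b) (expi t) < 0.
Proof.
move=> a0 ab b1 /andP[t0 t1] out; rewrite chord_expi pmulr_rlt0 //.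
have [ta|at_] := ltP t a.
  rewrite -[t - a]opprB mulrN sinN mulNr oppr_lt0 mulr_gt0 ?sin_pi_gt0 //; lra.
have {at_} bt : b < t by rewrite ltNge; apply: contra out => ->; rewrite at_.
rewrite -[b - t]opprB mulrN sinN mulrN oppr_lt0 mulr_gt0 ?sin_pi_gt0 //; lra.
Qed.

Lemma chord_end a b t : (t == a) || (t == b) -> aff (chord a b) (expi t) = 0.
Proof. by rewrite chord_expi => /orP[]/eqP->; rewrite subrr mulr0 sin0 ?(mul0r, mulr0). Qed.

Lemma chord_ge0 a b t : 0 <= a -> b < 1 -> a <= t <= b -> 0 <= aff (chord a b) (expi t).
Proof.
move=> a0 b1 /andP[at_ tb]; have [/chord_end->//|] := boolP ((t == a) || (t == b)).
rewrite negb_or => /andP[n1 n2]; apply/ltW/chord_gt0 => //.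
by rewrite !lt_neqAle at_ tb n2 eq_sym n1.
Qed.

Lemma chord_le0 a b t : 0 <= a -> a <= b -> b < 1 -> 0 <= t < 1 -> ~~ (a < t < b) ->
  aff (chord a b) (expi t) <= 0.
Proof.
move=> a0 ab b1 t01 out; have [/chord_end->//|ne] := boolP ((t == a) || (t == b)).
apply/ltW/chord_lt0 => //; apply: contra out => /andP[].
rewrite negb_or in ne; case/andP: ne => n1 n2.
by rewrite !lt_neqAle => -> ->; rewrite eq_sym n1 n2.
Qed.

Lemma expi_inj a b : 0 <= a < 1 -> 0 <= b < 1 -> expi a = expi b -> a = b.
Proof.
move=> /andP[a0 a1] hb e; apply/eqP; apply: contraT => ne.
(* The degenerate chord is the tangent at [expi a]; the rest of the circle lies strictly on its
   negative side. *)
have : aff (chord a a) (expi b) < 0.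
  by apply: chord_lt0 => //; rewrite -eq_le.
by rewrite -e chord_end ?eqxx // ltxx.
Qed.

Lemma onS_expi t : onS (expi t).
Proof. by rewrite /onS /= cos2Dsin2. Qed.

Lemma expiD1 t : expi (t + 1) = expi t.
Proof.
rewrite /expi; have -> : 2 * pi * (t + 1) = 2 * pi * t + pi *+ 2 :> R by rewrite -mulr_natl; ring.
by rewrite cosD2pi sinD2pi.
Qed.

Lemma expiDn t n : expi (t + n%:R) = expi t.
Proof. by elim: n => [|n IH]; rewrite ?addr0 // -natr1 addrA expiD1. Qed.

Lemma expi_onto p : onS p -> exists2 t, 0 <= t < 1 & p = expi t.
Proof.
case: p => x y; rewrite /onS /= => xy; have p0 := pi_gt0 R.
have x1 : -1 <= x <= 1 by have := sqr_ge0 y; nra.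
have a0 := acos_ge0 x1; have a1 := acos_lepi x1.
have sa : sin (acos x) = `|y|.
  by rewrite sin_acos // -sqrtr_sqr; congr Num.sqrt; lra.
have ca : cos (acos x) = x by apply: acosK; rewrite in_itv.
pose t := acos x / (2 * pi).
have tE : 2 * pi * t = acos x by rewrite /t mulrC divfK //; apply/eqP; nra.
have [y0|y0] := leP 0 y.
  exists t; first by nra.
  by rewrite /expi tE ca sa ger0_norm.
have ap : 0 < acos x.
  rewrite lt_neqAle a0 andbT; apply/eqP => e.
  by move: sa; rewrite -e sin0 => /esym/eqP; rewrite normr_eq0 lt_eqF.
exists (1 - t); first by nra.
have -> : expi (1 - t) = expi (- t) by rewrite addrC expiD1.
by rewrite /expi mulrN tE cosN sinN ca sa ltr0_norm // opprK.
Qed.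

Lemma cpow_expi t n : cpow (expi t) n = expi (n%:R * t).
Proof.
elim: n => [|n IH]; first by rewrite /expi mul0r mulr0 cos0 sin0.
rewrite /= IH -natr1 /cmul /expi /=.
have -> : 2 * pi * ((n%:R + 1) * t) = 2 * pi * t + 2 * pi * (n%:R * t) by ring.
by rewrite cosD sinD; congr (_, _); ring.
Qed.

Definition area p q r : R := (q.1 - p.1) * (r.2 - p.2) - (q.2 - p.2) * (r.1 - p.1).

Lemma area_expi a b t : area (expi a) (expi b) (expi t) =
  4 * (sin (pi * (b - a)) * sin (pi * (t - b)) * sin (pi * (t - a))).
Proof.
have E s : expi s = (cos (pi * s) ^+ 2 - sin (pi * s) ^+ 2, 2 * sin (pi * s) * cos (pi * s)).
  have -> : expi s = (cos (pi * s + pi * s), sin (pi * s + pi * s)).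
    by rewrite /expi; congr (cos _, sin _); ring.
  by rewrite cosD sinD; congr (_, _); ring.
have o s := cos2Dsin2 (pi * s).
(* The factors cos^2 + sin^2 = 1 make the expression homogeneous in the half-angle coordinates, so
   that [ring] can close the identity. *)
transitivity (
  (cos (pi * a) ^+ 2 + sin (pi * a) ^+ 2) *
    ((expi b).1 * (expi t).2 - (expi b).2 * (expi t).1) -
  (cos (pi * b) ^+ 2 + sin (pi * b) ^+ 2) *
    ((expi a).1 * (expi t).2 - (expi a).2 * (expi t).1) +
  (cos (pi * t) ^+ 2 + sin (pi * t) ^+ 2) *
    ((expi a).1 * (expi b).2 - (expi a).2 * (expi b).1)).
  by rewrite !o /area; ring.
rewrite !E /= !mulrBr !sinB; ring.
Qed.

Lemma area_gt0 a b t : 0 <= a -> a < b -> b < t -> t < 1 ->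
  0 < area (expi a) (expi b) (expi t).
Proof.
move=> a0 ab bt t1; rewrite area_expi !mulr_gt0 ?sin_pi_gt0 //; lra.
Qed.

Lemma conv_segment A p q k : 0 <= k <= 1 -> A p -> A q ->
  conv A (k * p.1 + (1 - k) * q.1, k * p.2 + (1 - k) * q.2).
Proof.
move=> /andP[k0 k1] Ap Aq.
exists 2%N, (fun i => if i == 0 :> nat then k else 1 - k).
exists (fun i => if i == 0 :> nat then p else q); do !split.
- by move=> i; case: ifP => _ //; rewrite subr_ge0.
- by rewrite !big_ord_recl big_ord0 /=; ring.
- by move=> i; case: ifP.
- by rewrite !big_ord_recl !big_ord0 /= !addr0.
Qed.

Lemma chords_cross A B a b t u : 0 <= a -> a < b -> b < t -> t < u -> u < 1 ->
  A (expi a) -> A (expi t) -> B (expi b) -> B (expi u) -> exists2 p, conv A p & conv B p.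
Proof.
move=> a0 ab bt tu u1 Aa At Bb Bu.
have := @area_gt0 b t u ltac:(lra) bt tu u1.
have := @area_gt0 a b u a0 ab ltac:(lra) u1.
have := @area_gt0 a t u a0 ltac:(lra) tu u1.
have := @area_gt0 a b t a0 ab bt ltac:(lra).
move: (expi a) (expi b) (expi t) (expi u) Aa At Bb Bu => p q r s Ap Ar Bq Bs.
set x4 := area p q r; set x2 := area p r s; set x3 := area p q s; set x1 := area q r s.
move=> h4 h2 h3 h1.
have n1 : x1 + x3 != 0 by rewrite gt_eqF // addr_gt0.
have n2 : x2 + x4 != 0 by rewrite gt_eqF // addr_gt0.
(* Both sums are twice the area of the quadrilateral, cut along either diagonal. *)
have E : x1 + x3 = x2 + x4 by rewrite /x1 /x2 /x3 /x4 /area; ring.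
have frac (x y : R) : 0 < x -> 0 < y -> 0 <= x / (x + y) <= 1.
  move=> x0 y0; have xy : 0 < x + y by rewrite addr_gt0.
  by rewrite ler_pdivrMr // mul1r lerDl (ltW y0) divr_ge0 // ltW.
(* The diagonals meet where each end is weighted by the area of the triangle beyond the other
   diagonal. *)
exists (x1 / (x1 + x3) * p.1 + (1 - x1 / (x1 + x3)) * r.1,
        x1 / (x1 + x3) * p.2 + (1 - x1 / (x1 + x3)) * r.2).
  by apply: conv_segment; rewrite ?frac.
have -> : (x1 / (x1 + x3) * p.1 + (1 - x1 / (x1 + x3)) * r.1,
        x1 / (x1 + x3) * p.2 + (1 - x1 / (x1 + x3)) * r.2) =
  (x2 / (x2 + x4) * q.1 + (1 - x2 / (x2 + x4)) * s.1,
   x2 / (x2 + x4) * q.2 + (1 - x2 / (x2 + x4)) * s.2).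
  have c (x y v w : R) : x + y != 0 ->
      x / (x + y) * v + (1 - x / (x + y)) * w = (x * v + y * w) / (x + y).
    by move=> h; field.
  rewrite !c // E; congr (_ / _, _ / _); rewrite /x1 /x2 /x3 /x4 /area; ring.
by apply: conv_segment; rewrite ?frac.
Qed.

End Circle.

(** * The isomorphism *)

(** Each class, listed increasingly, becomes a cycle under [next], whose only weak descent is the
    wrap-around. *)
Lemma incr_perm_exists d (e : rel 'I_d) : equivalence_rel e ->
  exists x : {perm 'I_d}, incr (@nat_of_ord d) x /\ forall i j, (j \in porbit x i) = e i j.
Proof.
move=> ee; have er i : e i i by have [] := ee i i i.
have et i j : e i j -> e i =1 e j by move=> h k; have [_ ->] := ee i j k.
pose B i := [seq j <- enum 'I_d | e i j].
have uB i : uniq (B i) by rewrite filter_uniq ?enum_uniq.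
have BE i j : (j \in B i) = e i j by rewrite mem_filter mem_enum andbT.
have eB i j : e i j -> B i = B j by move=> h; apply: eq_filter => k; exact: et.
have sB i : sorted (relpre (@nat_of_ord d) ltn) (B i).
  apply: sorted_filter => [a b c|]; first exact: ltn_trans.
  by rewrite -sorted_map val_enum_ord iota_ltn_sorted.
have mB i a b : (a <= b < size (B i) -> nth i (B i) a <= nth i (B i) b)%N.
  move=> /andP[]; rewrite leq_eqVlt => /orP[/eqP->//|ab] bs.
  apply/ltnW/(sorted_ltn_nth _ _ (sB i)); rewrite ?inE //; last exact: ltn_trans bs.
  by move=> ? ? ?; exact: ltn_trans.
pose f i := next (B i) i.
have ef i : e i (f i) by rewrite -BE mem_next BE.
have finj : injective f.
  move=> i j fij; have eij : e i j by rewrite (et _ _ (ef i)) fij -(et _ _ (ef j)) er.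
  by move: fij; rewrite /f (eB _ _ eij) => /(can_inj (prev_next (uB j))).
pose x := perm finj; exists x.
have xe i j : j \in porbit x i -> e i j.
  apply: (@porbit_closed _ _ (e i)) => // k eik; rewrite permE.
  by rewrite (et _ _ eik) ef.
have xE i j : (j \in porbit x i) = e i j.
  apply/idP/idP => [|eij]; first exact: xe.
  have nE n : iter n (next (B i)) i = (x ^+ n)%g i.
    elim: n => [|n IH]; first by rewrite expg0 perm1.
    by rewrite iterS IH expgSr permM permE /f -(@eB i) // xe // mem_porbit.
  have : fconnect (next (B i)) i j.
    by rewrite (fconnect_cycle (cycle_next (uB i))) BE.
  by move=> /iter_findex <-; rewrite nE mem_porbit.
split=> // i j; rewrite xE permE /f.
have ip : i \in B i by rewrite BE.
rewrite -BE => + jp; have iB := ip; have jB := jp; rewrite -!index_mem in iB jB.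
have ni := nth_index i ip; have nj := nth_index i jp; rewrite next_nth ip.
have := @mB i; case E : (B i) iB jB ni nj (sB i) => [//|y p] iB jB ni nj sp mn.
(* Before the last entry [next] goes up, against the assumed weak descent. At the last entry the
   default of [nth] is the head [y], which is the wrap-around. *)
have [h|h] := ltnP (index i (y :: p)) (size p).
  suff lt : (i < nth y p (index i (y :: p)))%N by rewrite leqNgt lt.
  rewrite (set_nth_default i) // -[nth i p _]/(nth i (y :: p) (index i (y :: p)).+1).
  rewrite -[X in (X < _)%N]/(nat_of_ord i) -[X in (nat_of_ord X < _)%N]ni.
  apply: (sorted_ltn_nth _ _ sp); rewrite ?inE //.
  by move=> ? ? ?; exact: ltn_trans.
rewrite nth_default // => _; apply/andP; split.
  by rewrite -nj; apply: (mn 0); rewrite jB.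
rewrite -[X in (_ <= nat_of_ord X)%N]ni -nj; apply: mn; rewrite iB andbT.
by apply: leq_trans h; exact: jB.
Qed.

Section Main.
Variables (R : realType) (d : nat).
Hypothesis d_gt0 : 0 < d.
Local Notation Sd := {perm 'I_d}.
Local Notation C := (R * R)%type.
Local Open Scope ring_scope.
Implicit Types (w v : R -> Sd) (l : seq R) (s r : R).

Let d0 : 0 < d%:R :> R. Proof. by rewrite ltr0n. Qed.

Lemma preim_range s (i : 'I_d) : 0 <= s < 1 -> 0 <= (s + i%:R) / d%:R < 1.
Proof.
move=> /andP[s0 s1]; have i0 : 0 <= i%:R :> R by rewrite ler0n.
have : (i.+1%:R <= d%:R :> R) by rewrite ler_nat.
rewrite -natr1 => id; rewrite ltr_pdivrMr // mul1r divr_ge0 ?addr_ge0 ?ler0n //=; lra.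
Qed.

Lemma preim_pow s (i : 'I_d) : cpow (preim s i) d = expi s.
Proof. by rewrite cpow_expi mulrC divfK ?gt_eqF // expiDn. Qed.

Lemma preim_inj s r (i j : 'I_d) : 0 <= s < 1 -> 0 <= r < 1 ->
  preim s i = preim r j -> s = r /\ i = j.
Proof.
move=> s1 r1 e; have sr : s = r.
  by apply: expi_inj => //; rewrite -(preim_pow s i) e preim_pow.
split=> //; have /expi_inj := e; rewrite !preim_range // => /(_ isT isT).
move=> /(congr1 (fun x => x * d%:R)); rewrite !divfK ?gt_eqF // sr => /addrI/eqP.
by rewrite eqr_nat => /eqP/val_inj.
Qed.

Lemma preim_onto (z : C) : onS z -> exists s (i : 'I_d), 0 <= s < 1 /\ z = preim s i.
Proof.
move=> /expi_onto[t /andP[t0 t1] ->].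
have td0 : 0 <= t * d%:R by rewrite mulr_ge0 // ler0n.
(* Sheet and level are the integer and fractional parts of [t * d%:R]. *)
have /andP[n1 n2] := truncn_itv td0; set n := Num.truncn _ in n1 n2.
have nd : (n < d)%N by rewrite -(ltr_nat R); apply: le_lt_trans n1 _; rewrite gtr_pMl.
exists (t * d%:R - n%:R), (Ordinal nd); split.
  by rewrite subr_ge0 n1 ltrBlDl natr1.
by rewrite /preim subrK mulfK ?gt_eqF.
Qed.

(** * Orbits on a grid as points of the circle *)

Section Grid.
Variables (l : seq R) (w : R -> Sd).
Hypothesis gl : grid l.
Local Notation T := ('I_d * 'I_(size (0%R :: l)))%type.

Definition wsum : {perm T} := lsum (size (0 :: l)) (map w (0 :: l)).

Lemma wsumE m j : wsum (m, j) = (w (lvl j) m, j).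
Proof. by rewrite lsumE (nth_map 0). Qed.

Lemma mem_porbit_wsum m j u :
  (u \in porbit wsum (m, j)) = (u.1 \in porbit (w (lvl j)) m) && (u.2 == j).
Proof. by rewrite mem_porbit_lsum (nth_map 0). Qed.

Definition pt (t : T) : C := preim (lvl t.2) t.1.

Lemma ptE t : pt t = expi (theta t / d%:R).
Proof. by []. Qed.

Lemma pos_range (t : T) : 0 <= theta t / d%:R < 1.
Proof. by apply: preim_range; exact: lvl_range. Qed.

Lemma pos_lt (t u : T) : (theta t / d%:R < theta u / d%:R) = (lpos t < lpos u)%N.
Proof. by rewrite ltr_pM2r ?invr_gt0 // theta_lt. Qed.

Lemma pos_le (t u : T) : (theta t / d%:R <= theta u / d%:R) = (lpos t <= lpos u)%N.
Proof. by rewrite leNgt pos_lt -leqNgt. Qed.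

Definition ptorbit (t : T) : C -> Prop := fun z => exists2 v, v \in porbit wsum t & z = pt v.

(** Let [i] be the top of the orbit of [t]. If [u] is outside its span, the chord from [wsum i] to
    [i] (a tangent if [i] is fixed) separates, since [nocross_down] keeps the orbit of [u] outside.
    Otherwise some step from [v] to [wsum v] jumps over [u], and its chord separates: [nocross_up]
    keeps the orbit of [u] in that arc and [incr_gap] keeps the orbit of [t] out of it. *)
Lemma hulls_disjoint t u p : incr (@lpos d _) wsum -> nocross (@lpos d _) wsum ->
  u \notin porbit wsum t -> conv (ptorbit t) p -> conv (ptorbit u) p -> False.
Proof.
move=> inc nc ut ct cu.
have K0 : (0 < size (0%R :: l))%N by [].
have pinj := @lpos_inj d (size (0 :: l)).
have [i it imax] := porbit_max (@lpos d _) wsum t.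
have id_ : (lpos (wsum i) <= lpos i)%N by rewrite imax // perm_in_porbit.
have tin e : e \in porbit wsum t -> (lpos (wsum i) <= lpos e <= lpos i)%N.
  by move=> h; apply: inc => //; apply: porbit_trans h; rewrite porbit_sym.
have [uin|uout] := boolP (lpos (wsum i) <= lpos u <= lpos i)%N; last first.
  apply: (conv_separatedN (k := chord (theta (wsum i) / d%:R) (theta i / d%:R)) ct cu).
    move=> _ [e eo ->]; rewrite ptE chord_ge0 ?pos_le ?tin //.
      by case/andP: (pos_range (wsum i)).
    by case/andP: (pos_range i).
  move=> _ [e eo ->]; rewrite ptE chord_lt0 ?pos_le ?pos_range //.
  - by case/andP: (pos_range (wsum i)).
  - by case/andP: (pos_range i).
  apply: contra uout => h; rewrite porbit_sym in eo.
  apply: (@porbit_closed _ wsum [pred v | (lpos (wsum i) <= lpos v <= lpos i)%N] _ _ _ _ eo) => //.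
  by move=> v; exact: (nocross_down pinj inc nc id_).
have io : i \in porbit wsum (wsum i) by rewrite porbit_sym mem_porbit1.
have ti (e : T) : e \in porbit wsum (wsum i) -> e \in porbit wsum t.
  by move=> h; apply: porbit_trans h; rewrite perm_in_porbit.
have une (e : T) : e \in porbit wsum t -> (lpos e != lpos u)%N.
  by move=> h; apply: contraNneq ut => /pinj <-.
have ui := une _ it.
have cnd : (lpos (wsum i) <= lpos u < lpos i)%N.
  by case/andP: uin => -> h; rewrite ltn_neqAle eq_sym ui.
have [v vo /andP[vu uv]] := porbit_step io cnd.
have {}vo := ti _ vo; have vne := une v vo.
have uv' : (lpos v < lpos u < lpos (wsum v))%N by rewrite uv ltn_neqAle vne vu.
have vw : (lpos v < lpos (wsum v))%N := leq_ltn_trans vu uv.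
apply: (conv_separated (k := chord (theta v / d%:R) (theta (wsum v) / d%:R)) ct cu).
  move=> _ [e eo ->]; rewrite ptE chord_le0 ?pos_le ?pos_lt ?pos_range //.
  - by case/andP: (pos_range v).
  - exact: ltnW.
  - by case/andP: (pos_range (wsum v)).
  apply/negP => /andP[ve ev].
  suff : (lpos (wsum v) <= lpos e)%N by rewrite leqNgt ev.
  by apply: (incr_gap pinj) => //; apply: porbit_trans eo; rewrite porbit_sym.
move=> _ [e eo ->]; rewrite ptE chord_gt0 ?pos_lt //.
- by case/andP: (pos_range v).
- by case/andP: (pos_range (wsum v)).
apply: (@porbit_closed _ wsum [pred a | (lpos v < lpos a < lpos (wsum v))%N] _ _ _ _ eo) => //.
by move=> a; exact: (nocross_up pinj inc nc).
Qed.

(** The grid is arbitrary and may miss nontrivial levels, which is what later bounds their number. A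
    crossing between two blocks makes chords meet; within one block, the degree condition puts both
    points on one level, where [incr_gap] excludes it. *)
Lemma genus0_of_noncrossing (E : C -> C -> Prop) : NCd d E ->
  (forall s, 0 <= s < 1 -> incr (@nat_of_ord d) (w s) /\
    forall i j, (j \in porbit (w s) i) <-> E (preim s i) (preim s j)) ->
  genus0 (map w (0 :: l)).
Proof.
move=> [[[EonS [Erefl [Esym Etrans]]] Edeg] Enc] wE.
have inc x : x \in map w (0 :: l) -> incr (@nat_of_ord d) x.
  by move=> /mapP[s /(grid_range gl)/wE[] h _ ->].
have K0 : (0 < size (0%R :: l))%N by [].
have sz : size (map w (0 :: l)) = size (0 :: l) by rewrite size_map.
have ws := incr_lsum K0 sz inc; rewrite -/wsum in ws.
have pinj := @lpos_inj d (size (0 :: l)).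
have EX a : E (pt a) (pt (wsum a)).
  case: a => m j; rewrite wsumE /pt /=; apply/(proj2 (wE _ (lvl_range gl j))).
  exact: mem_porbit1.
apply: (nocross_genus0 d_gt0 K0 sz inc) => a b ab ba; rewrite -/wsum in ba *.
rewrite leqNgt; apply/negP => bb.
have [Eab|nE] := pselect (E (pt a) (pt b)).
  suff h : b \in porbit wsum a by have := incr_gap pinj ws h ab; lia.
  have := Edeg _ _ Eab; rewrite /pt !preim_pow => /expi_inj.
  rewrite !lvl_range // => /(_ isT isT)/(lvl_inj gl) ej.
  case: a b ej Eab {ab ba bb} => m j [n k] /= <- Eab.
  rewrite mem_porbit_wsum /= eqxx andbT; apply/(proj2 (wE _ (lvl_range gl j))).
  exact: Eab.
have onpt t : onS (pt t) by exact: onS_expi.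
have [p] := @chords_cross _ (block E (pt a)) (block E (pt b))
  (theta a / d%:R) (theta b / d%:R) (theta (wsum a) / d%:R) (theta (wsum b) / d%:R)
  (proj1 (andP (pos_range a))) ltac:(by rewrite pos_lt) ltac:(by rewrite pos_lt)
  ltac:(by rewrite pos_lt) (proj2 (andP (pos_range _)))
  (Erefl _ (onpt a)) (EX a) (Erefl _ (onpt b)) (EX b).
exact: Enc.
Qed.

End Grid.

(** * From factorizations to partitions and back *)

Lemma FS_grid w (e : seq R) : FS (delta d) w -> exists l,
  [/\ grid l, forall r, w r != 1%g -> r \in 0 :: l &
    forall r, r \in e -> 0 <= r < 1 -> r \in 0 :: l].
Proof.
move=> [[w01 [s ws]] _]; have [l [gl lE]] := grid_exists (s ++ e).
have in0l r : r \in s ++ e -> 0 <= r < 1 -> r \in 0 :: l.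
  move=> rs /andP[r0 r1]; have [->|ne] := eqVneq r 0; first by rewrite mem_head.
  by rewrite inE (negbTE ne) lE rs r1 lt_neqAle eq_sym ne r0.
exists l; split=> // r h.
  by apply: in0l; [rewrite mem_cat ws | exact: w01].
by apply: in0l; rewrite mem_cat h orbT.
Qed.

Lemma FS_nocross w l : FS (delta d) w -> grid l -> (forall r, w r != 1%g -> r \in 0 :: l) ->
  [/\ forall r, r \in 0 :: l -> incr (@nat_of_ord d) (w r),
    incr (@lpos d _) (wsum l w) & nocross (@lpos d _) (wsum l w)].
Proof.
move=> fs gl wl; have K0 : (0 < size (0%R :: l))%N by [].
have sz : size (map w (0 :: l)) = size (0 :: l) by rewrite size_map.
have := fs; rewrite (FS_genus0 d_gt0 (proj1 fs) gl wl) => g0.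
have [inc nc] := genus0_nocross d_gt0 K0 sz g0; split=> //.
  by move=> r rl; apply: inc; exact: map_f.
exact: incr_lsum.
Qed.

Lemma FS_perm w s : FS (delta d) w -> 0 <= s < 1 ->
  incr (@nat_of_ord d) (w s) /\ nocross (@nat_of_ord d) (w s).
Proof.
move=> fs s01; have [l [gl wl sl]] := FS_grid [:: s] fs.
have {}sl : s \in 0 :: l by apply: sl => //; rewrite mem_head.
have [inc _ nc] := FS_nocross fs gl wl; split; first exact: inc.
have [j sj] := lvl_onto sl.
move=> a b ab ba; have := nc (a, j) (b, j); rewrite !wsumE sj /lpos /=.
by rewrite !ltn_add2r !leq_add2r !ltn_pmul2r // leq_pmul2r // => /(_ ab ba).
Qed.

Lemma FS_out w s : FS (delta d) w -> ~~ (0 <= s < 1) -> w s = 1%g.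
Proof. by move=> [[w01 _] _]; apply: contraNeq => /w01. Qed.

Lemma Psi_preim w s r (i j : 'I_d) : 0 <= s < 1 -> 0 <= r < 1 ->
  Psi w (preim s i) (preim r j) <-> s = r /\ j \in porbit (w s) i.
Proof.
move=> s01 r01; split=> [[[_ e]|[q [q01 [a [b [e1 [e2 ab]]]]]]]|[<- h]].
- by have [<- ->] := preim_inj s01 r01 e; rewrite porbit_id.
- have [<- <-] : q = s /\ a = i by apply: preim_inj.
  by have [<- <-] : q = r /\ b = j by apply: preim_inj.
- by right; exists s; split=> //; exists i, j.
Qed.

Lemma degd_Psi w : degd d (Psi w).
Proof.
split; first split.
- by move=> z1 z2 [[? <-]//|[s [_ [i [j [-> [-> _]]]]]]]; split; exact: onS_expi.
- split=> [z oz|]; first by left.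
  split=> [z1 z2 [[oz <-]|[s [s01 [i [j [-> [-> ij]]]]]]]|]; first by left.
    by right; exists s; split=> //; exists j, i; rewrite /psi porbit_sym.
  move=> z1 z2 z3 [[oz <-]//|[s [s01 [i [j [-> [-> ij]]]]]]] h.
  have [k [r [r01 e]]] : exists k r, 0 <= r < 1 /\ z3 = preim r (k : 'I_d).
    suff /preim_onto[r [k h']] : onS z3 by exists k, r.
    by case: h => [[oz <-]//|[r [_ [a [b [_ [-> _]]]]]]]; exact: onS_expi.
  move: h; rewrite e => /(Psi_preim w _ _ s01 r01)[<- jk].
  by apply/Psi_preim => //; split=> //; exact: porbit_trans ij jk.
- move=> z1 z2 [[? <-]//|[s [_ [i [j [-> [-> _]]]]]]].
  by rewrite !preim_pow.
Qed.

Lemma FS_NCd w : FS (delta d) w -> NCd d (Psi w).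
Proof.
move=> fs; split; first exact: degd_Psi.
move=> _ _ /preim_onto[s [i [s01 ->]]] /preim_onto[r [j [r01 ->]]] npsi p c1 c2.
(* The levels of the two blocks may carry trivial factors, so they are adjoined to the grid. *)
have [l [gl wl sl]] := FS_grid [:: s; r] fs.
have {}sl q : q \in [:: s; r] -> exists k : 'I_(size (0 :: l)), lvl k = q.
  move=> qs; apply: lvl_onto; apply: sl => //.
  by move: qs; rewrite !inE => /orP[]/eqP->.
have [a sa] := sl s (mem_head _ _).
have [b rb] := sl r ltac:(by rewrite !inE eqxx orbT).
have [_ inc nc] := FS_nocross fs gl wl.
have sub q (k : 'I_d) (c : 'I_(size (0 :: l))) : 0 <= q < 1 -> lvl c = q ->
    forall z, block (Psi w) (preim q k) z -> ptorbit w (k, c) z.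
  move=> q01 cq z; rewrite /block => h.
  have /preim_onto[q' [k' [q'01 e]]] : onS z by have [[/(_ _ _ h)[]]] := degd_Psi w.
  move: h; rewrite e => /(Psi_preim w _ _ q01 q'01)[<- kk].
  by exists (k', c); rewrite ?mem_porbit_wsum /= ?cq ?kk ?eqxx // /pt /= cq.
apply: (hulls_disjoint gl inc nc _ (conv_sub (sub _ _ _ s01 sa) c1)
  (conv_sub (sub _ _ _ r01 rb) c2)).
apply/negP; rewrite mem_porbit_wsum /= sa => /andP[ij /eqP ba]; apply: npsi.
by apply/Psi_preim => //; split=> //; rewrite -sa -rb ba.
Qed.

Lemma Psi_FS_inj v w : FS (delta d) v -> FS (delta d) w ->
  same_part (Psi v) (Psi w) -> forall s, v s = w s.
Proof.
move=> fv fw vw s; have [s01|s01] := boolP (0 <= s < 1); last by rewrite !FS_out.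
apply: (@incr_ext _ (@nat_of_ord d)) => [|||i j].
- exact: ord_inj.
- exact: (FS_perm fv s01).1.
- exact: (FS_perm fw s01).1.
have := vw (preim s i) (preim s j); rewrite !Psi_preim // => -[h1 h2].
by apply/idP/idP => h; [have [] := h1 (conj erefl h) | have [] := h2 (conj erefl h)].
Qed.

Lemma ell_eq0 (x : Sd) : ell x = 0%N -> x = 1%g.
Proof.
move=> e; have h := ell_ncyc x; have [[|t ts] [xE _]] := tprod_exists x.
  by rewrite -xE /tprod big_nil.
by rewrite card_ord -[size _]/(size ts).+1 => h1; rlia.
Qed.

Lemma genus0_size l w : genus0 (map w (0 :: l)) -> (forall r, r \in l -> w r != 1%g) ->
  (size l < d)%N.
Proof.
move=> /eqP g0 w1; have : (size l <= sumn (map (@ell d) (map w l)))%N.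
  elim: l w1 {g0} => //= r l IH w1.
  have := IH (fun q ql => w1 q (mem_behead (s := r :: l) ql)).
  have : (ell (w r) != 0)%N by apply: contraNneq (w1 r (mem_head _ _)) => /ell_eq0->.
  lia.
by move: g0 => /=; lia.
Qed.

Lemma FS_onto (E : C -> C -> Prop) : NCd d E ->
  exists w, FS (delta d) w /\ same_part (Psi w) E.
Proof.
move=> NE; have [[[EonS [Erefl [Esym Etrans]]] Edeg] Enc] := NE.
have exw s : exists x : Sd, if 0 <= s < 1 then incr (@nat_of_ord d) x /\
    forall i j, (j \in porbit x i) <-> E (preim s i) (preim s j) else x = 1%g.
  have [s01|s01] := boolP (0 <= s < 1); last by exists 1%g.
  have [|x [ix xe]] := @incr_perm_exists d (fun i j => `[< E (preim s i) (preim s j) >]).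
    move=> i j k; split; first by apply/asboolP/Erefl; exact: onS_expi.
    move=> /asboolP ij; apply/asboolP/asboolP => h; last exact: Etrans ij h.
    exact: Etrans (Esym _ _ ij) h.
  by exists x; split=> // i j; rewrite xe; split=> /asboolP.
have [w wP] := choice exw.
have wE s : 0 <= s < 1 -> incr (@nat_of_ord d) (w s) /\
    forall i j, (j \in porbit (w s) i) <-> E (preim s i) (preim s j).
  by move=> s01; have := wP s; rewrite s01.
have w01 s : w s != 1%g -> 0 <= s < 1.
  by apply: contraNT => s01; have := wP s; rewrite (negbTE s01) => ->.
(* Finiteness of the support has to be proved. Any grid of nontrivial levels has genus zero, so by
   [genus0_size] it has fewer than [d] levels besides 0; adjoining missed levels must stop, and [n]
   bounds the number of rounds left. *)
have [l gl wl] : exists2 l, grid l & forall r, w r != 1%g -> r \in 0 :: l.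
  suff H n l : grid l -> (forall r, r \in l -> w r != 1%g) -> (d - size l <= n)%N ->
      exists2 l, grid l & forall r, w r != 1%g -> r \in 0 :: l.
    by apply: (H d [::]) => //; lia.
  elim: n l => [|n IH] l gl lw le.
    have := genus0_size (genus0_of_noncrossing gl NE wE) lw; lia.
  have [cov|/existsNP[r /not_implyP[wr /negP rl]]] :=
    pselect (forall r, w r != 1%g -> r \in 0 :: l); first by exists l.
  have /andP[r0 r1] := w01 r wr.
  have [l' [gl' l'E]] := grid_exists (r :: l).
  have ll' : l' =i r :: l.
    move=> q; rewrite l'E; case ql : (q \in r :: l) => //=.
    move: ql; rewrite inE => /orP[/eqP->|ql].
      rewrite r1 andbT lt_neqAle r0 andbT eq_sym.
      by apply: contraNneq rl => ->; rewrite mem_head.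
    have /andP[q0 ->] := grid_range gl (mem_behead (s := 0 :: l) ql).
    rewrite andbT; have := proj1 gl; rewrite /= lt_path_sortedE => /andP[/allP + _].
    exact.
  have ul : uniq (r :: l).
    rewrite /=; apply/andP; split; first by apply: contra rl; rewrite inE => ->; rewrite orbT.
    have := proj1 gl; rewrite /= lt_path_sortedE => /andP[_]; exact: lt_sorted_uniq.
  have ul' : uniq l'.
    have := proj1 gl'; rewrite /= lt_path_sortedE => /andP[_]; exact: lt_sorted_uniq.
  apply: (IH l') => //.
    by move=> q; rewrite ll' inE => /orP[/eqP->|/lw].
  by have /perm_size -> /= := uniq_perm ul' ul ll'; lia.
have mw : multS w by split=> //; exists (0 :: l).
exists w; split.
  by apply/(FS_genus0 d_gt0 mw gl wl); exact: genus0_of_noncrossing wE.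
move=> z1 z2; split=> [[[oz <-]|[s [s01 [i [j [-> [-> ij]]]]]]]|h]; first exact: Erefl.
  by apply/(proj2 (wE s s01)).
have [o1 o2] := EonS _ _ h.
have [s [i [s01 e1]]] := preim_onto o1; have [r [j [r01 e2]]] := preim_onto o2.
have := Edeg _ _ h; rewrite e1 e2 !preim_pow => /(expi_inj s01 r01) sr.
apply/Psi_preim => //; split=> //; apply/(proj2 (wE s s01)).
by rewrite e1 e2 -sr in h.
Qed.

(** * Comparison of the two orders *)

Lemma conj_comp (g a : Sd) : comp (comp g a) g^-1 = (a ^ g)%g.
Proof. by rewrite /comp conjgE. Qed.

(* In FI the factor at 1 moves to 0 after conjugation by delta: the length of
   the merged factor is forced, so merging is itself length-additive. *)
Lemma FI_merge_ell u w : FI (delta d) u -> FS (delta d) w -> FIequiv (delta d) u (toI w) ->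
  w 0 = (u 0%R * (u 1%R ^ delta d))%g /\ ell (w 0) = (ell (u 0%R) + ell (u 1%R))%N.
Proof.
move=> /(FI_genus0 d_gt0)[s us gu] [_ /(FI_genus0 d_gt0)[s' ws gw]] [uw].
have w0E : toI w 0 = w 0 by rewrite /toI lexx ltr01.
have w1E : toI w 1 = 1%g by rewrite /toI ltxx andbF.
rewrite w0E w1E !conj_comp conj1g /comp mulg1 => e.
have w0 : w 0 = (u 0%R * (u 1%R ^ delta d))%g by [].
split=> //.
have ss := interior_support_uniq us ws uw.
have mE : map (toI w) s' = map u s.
  rewrite -ss; apply/esym/eq_in_map => r rs; apply: uw.
  by case: us => _ [h _]; exact: h.
have := gu; have := gw; rewrite w0E w1E mE /genus0 /lmono /= !cprod_cons !cprod_cat.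
rewrite !map_cat !sumn_cat /= !cprod_cons cprod_nil ell1 !mul1g w0.
set P := cprod (map u s); set S := sumn _.
(* Both elements are conjugate to the product of [(u 1)^-1], [delta d], [(u 0)^-1] and [P^-1]. *)
have -> : ell ((P * (u 0%R * u 1%R ^ (delta d)))^-1 * delta d)%g =
          ell ((u 1%R * P * u 0%R)^-1 * delta d)%g.
  rewrite -[LHS](ellJ _ (delta d)^-1%g) -[RHS](ellJ _ ((u 1%R)^-1 * delta d)^-1%g); congr ell.
  rewrite !conjgE !invgK !invMg !invgK !mulgA mulgV mul1g.
  by rewrite !mulgK !mulgVK.
by move=> /eqP h1 /eqP h2; rlia.
Qed.

(** At interior levels the order passes to orbits directly. At 0, the length additivity from
    [FI_merge_ell] puts the orbits of both merged factors of [u] inside those of [w 0]. *)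
Lemma FSle_refines v w : FS (delta d) w -> FSle (delta d) v w -> refines (Psi v) (Psi w).
Proof.
move=> fw [v' [u [fv' [fu [vv' [uw vu]]]]]].
have [w0 lw] := FI_merge_ell fu fw uw.
have [vI v01] := vv'; have [uI _] := uw.
have v0 : v 0 = (v' 0%R * (v' 1%R ^ delta d))%g.
  move: v01; rewrite /toI lexx ltr01 ltxx andbF !conj_comp conj1g /comp mulg1.
  by move=> ->.
suff H s : 0 <= s < 1 -> forall i, v s i \in porbit (w s) i.
  move=> z1 z2 [[o <-]|[s [s01 [i [j [-> [-> ij]]]]]]]; first by left.
  right; exists s; split=> //; exists i, j; do 2!split=> //.
  exact: porbit_sub (H s s01) ij.
move=> /andP[s0 s1] i; have [->|ne] := eqVneq s 0; last first.
  have s01 : 0 < s < 1 by rewrite lt_neqAle eq_sym ne s0.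
  have := vu s; rewrite vI // uI // /toI s0 s1 /= => h; exact: absle_porbit.
have := lw; rewrite w0 -(ellJ (u 1) (delta d)) => /ell_additive_porbit h.
rewrite v0 permM; apply: (@porbit_trans _ _ _ (v' 0 i)).
  by apply: (porbit_sub (x := _) (fun k => (h k).1)); exact: absle_porbit.
apply: (porbit_sub (fun k => (h k).2)).
by apply: absle_porbit; rewrite absleJ.
Qed.

(** The representatives that are trivial at 1 already witness the order. *)
Lemma refines_FSle v w : FS (delta d) v -> FS (delta d) w ->
  refines (Psi v) (Psi w) -> FSle (delta d) v w.
Proof.
move=> fv fw vw; exists (toI v), (toI w); do !split=> //; try by case: fv; case: fw.
move=> s; rewrite /toI; case: ifP => s01; last exact: abslexx.
have [iv nv] := FS_perm fv s01; have [iw _] := FS_perm fw s01.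
apply: absle_of_porbit => // i.
have /vw : Psi v (preim s i) (preim s (v s i)).
  by apply/Psi_preim => //; split=> //; exact: mem_porbit1.
by move=> /(Psi_preim _ _ _ s01 s01)[].
Qed.

End Main.

(* Psi restricts to a poset isomorphism F(Sym_d, delta, S) ~= NC_d(S). *)
Theorem theorem6p11 (R : realType) (d : nat) (hd : (0 < d)%N) :
  (* Psi maps F(Sym_d,delta,S) into NC_d(S) *)
  (forall w : R -> {perm 'I_d}, FS (delta d) w -> NCd d (Psi w)) /\
  (* injective *)
  (forall v w : R -> {perm 'I_d}, FS (delta d) v -> FS (delta d) w ->
     same_part (Psi v) (Psi w) -> forall s, v s = w s) /\
  (* onto NC_d(S) *)
  (forall E : (R * R) -> (R * R) -> Prop, NCd d E ->
     exists w : R -> {perm 'I_d}, FS (delta d) w /\ same_part (Psi w) E) /\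
  (* order-preserving and order-reflecting *)
  (forall v w : R -> {perm 'I_d}, FS (delta d) v -> FS (delta d) w ->
     (FSle (delta d) v w <-> refines (Psi v) (Psi w))).
Proof.
split; first exact: FS_NCd.
split; first exact: Psi_FS_inj.
split; first exact: FS_onto.
move=> v w fv fw; split; first exact: FSle_refines.
exact: refines_FSle.
Qed.
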